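(* Fix an integer $k\ge 2$. For each $n\ge1$, let $\mathsf R_n=(r_{n,1},\ldots,r_{n,n})$ and $\mathsf Q_n=(q_{n,1},\ldots,q_{n,n})$ belong to $[0,L]^n$, where $0<L<\infty$ is fixed (independent of $n$). Suppose $\mathsf R_n\succeq\mathsf Q_n$ (that is, $\mathsf R_n$ majorizes $\mathsf Q_n$), and that for some $a\in(0,L]$, $$\limsup_{n\to\infty}\frac{\#\{i:r_{n,i}>0\}}{n}<\liminf_{n\to\infty}\frac{\#\{i:q_{n,i}\ge a\}}{n}.$$ Then there exist $0<t_{\mathrm s}<t_{\ell}<\infty$ such that, for each fixed $t>0$: if $0<t<t_{\mathrm s}$, then $\mu_n(t\,\mathsf R_n)>\mu_n(t\,\mathsf Q_n)$ for all sufficiently large $n$; and if $t>t_{\ell}$, then $\mu_n(t\,\mathsf R_n)<\mu_n(t\,\mathsf Q_n)$ for all sufficiently large $n$.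
   Context: Spatial matching model: fix the dimension $k$. There are $n$ supply nodes with locations $s_1,\ldots,s_n$ and $n$ demand nodes with locations $d_1,\ldots,d_n$; all $2n$ locations are mutually independent and uniform on $[0,1]^k$. For a deterministic vector $\mathsf R=(r_1,\ldots,r_n)\in[0,\infty)^n$ of normalized service radii, $G_n(\mathsf R)$ is the random bipartite graph between supply nodes and demand nodes in which supply $i$ and demand $j$ are adjacent if and only if $\|s_i-d_j\|_2\le r_i\,n^{-1/k}$. $M(G)$ denotes the cardinality of a maximum matching of $G$, and $\mu_n(\mathsf R):=\mathbb E[M(G_n(\mathsf R))]$. Majorization: for $\mathbf x\in\mathbb R^n$, let $\mathbf x^{\downarrow}$ be its decreasing rearrangement. $\mathbf x\succeq\mathbf y$ means $\sum_{i=1}^{\ell}x_i^{\downarrow}\ge\sum_{i=1}^{\ell}y_i^{\downarrow}$ for all $1\le\ell<n$, and $\sum_{i=1}^n x_i=\sum_{i=1}^n y_i$. For $t>0$, $t\,\mathbf x=(tx_1,\ldots,tx_n)$. *)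

(* Defs.v *)
From HB Require Import structures.
From mathcomp Require Import all_boot all_order all_algebra.
From mathcomp Require Import all_classical all_reals all_analysis.

Set Implicit Arguments.
Unset Strict Implicit.
Unset Printing Implicit Defensive.

Import Order.TTheory GRing.Theory Num.Theory.
Import numFieldNormedType.Exports.

Local Open Scope classical_set_scope.
Local Open Scope ring_scope.

(* The library has binary product measures but no n-fold one: the law of n
   independent random variables of law P is built on n.-tuple T by recursion on
   n; iid_cylinder below is its defining property. *)
Section iid.
Context {d : measure_display} {T : measurableType d} {R : realType}.
Variable P : probability T R.

Definition tuple_cons n (x : T * n.-tuple T) : n.+1.-tuple T :=
  [tuple of x.1 :: x.2].

Lemma measurable_tuple_cons n : measurable_fun setT (@tuple_cons n).
Proof. exact: measurable_cons. Qed.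

HB.instance Definition _ n :=
  isMeasurableFun.Build _ _ _ _ (@tuple_cons n) (@measurable_tuple_cons n).

Fixpoint iid (n : nat) : probability (n.-tuple T) R :=
  match n with
  | 0 => dirac [tuple]
  | m.+1 => distribution (P \x iid m)%E (@tuple_cons m)
  end.

Lemma iid_cylinder n (A : 'I_n -> set T) : (forall i, measurable (A i)) ->
  iid n [set x | forall i, A i (tnth x i)] = (\prod_(i < n) P (A i))%E.
Proof.
elim: n A => [|n IHn] A mA /=.
  by rewrite big_ord0 diracE mem_set// => -[].
pose B := [set x : n.-tuple T | forall i, A (lift ord0 i) (tnth x i)].
have mB : measurable B.
  have -> : B = \bigcap_(i in [set: 'I_n])
      ((fun x : n.-tuple T => tnth x i) @^-1` A (lift ord0 i)).
    by apply/seteqP; split=> x Bx i => [_|]; exact: Bx.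
  apply: fin_bigcap_measurable => // i _.
  by rewrite -[X in measurable X]setTI; exact: (measurable_tnth i).
rewrite /distribution /pushforward /=.
have -> : @tuple_cons n @^-1` [set x | forall i, A i (tnth x i)] =
    A ord0 `*` B.
  apply/seteqP; split=> [[x s] h|[x s] [/= Ax Bs] i] /=.
    split; first exact: (h ord0).
    by move=> i; have := h (lift ord0 i); rewrite /tuple_cons tnthS.
  have [j ->|->] := unliftP ord0 i; last exact: Ax.
  by rewrite /tuple_cons tnthS; exact: Bs.
by rewrite product_measure1E// big_ord_recl
  -(IHn (fun i => A (lift ord0 i))).
Qed.

End iid.

Section matching.
Variables S D : finType.

(* A bipartite graph with sides S and D is the set of its edges. *)
Definition is_matching (G M : {set S * D}) : bool :=
  (M \subset G) &&
  [forall e in M, forall f in M, (e != f) ==> (e.1 != f.1) && (e.2 != f.2)].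

Definition max_matching (G : {set S * D}) : nat :=
  \max_(M : {set S * D} | is_matching G M) #|M|.

End matching.

Section spatial_matching.
Variable R : realType.

(* [`| x |] on 'rV[R]_k is the sup norm, hence an explicit Euclidean distance. *)
Definition dist2 (k : nat) (x y : k.-tuple R) : R :=
  Num.sqrt (\sum_(i < k) (tnth x i - tnth y i) ^+ 2).

Definition geom_graph (k n : nat) (r : 'rV[R]_n) (s d : n.-tuple (k.-tuple R)) :
    {set 'I_n * 'I_n} :=
  [set e | dist2 (tnth s e.1) (tnth d e.2) <=
           r ord0 e.1 * n%:R `^ (- k%:R^-1)]%SET.

Definition uniform_cube (k : nat) :
    probability (k.-tuple (measurableTypeR R)) R :=
  iid (uniform_prob (@ltr01 R)) k.

(* The supply locations are the first component, the demand locations the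
   second. *)
Definition locations (k n : nat) :
    probability (n.-tuple (k.-tuple (measurableTypeR R)) *
                 n.-tuple (k.-tuple (measurableTypeR R)))%type R :=
  (iid (uniform_cube k) n \x iid (uniform_cube k) n)%E.

Definition mu (k n : nat) (r : 'rV[R]_n) : \bar R :=
  'E_(locations k n)[fun sd => (max_matching (geom_graph r sd.1 sd.2))%:R]%E.

Definition decreasing_rearrangement (n : nat) (x : 'rV[R]_n) : seq R :=
  sort >=%R [seq x ord0 i | i <- enum 'I_n].

Definition majorizes (n : nat) (x y : 'rV[R]_n) : Prop :=
  (forall l : nat, (1 <= l < n)%N ->
     \sum_(i < l) (decreasing_rearrangement x)`_i >=
     \sum_(i < l) (decreasing_rearrangement y)`_i) /\
  \sum_(i < n) x ord0 i = \sum_(i < n) y ord0 i.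

End spatial_matching.

(* Main.v *)
Require Import Defs.
From mathcomp Require Import all_boot all_order all_algebra.
From mathcomp Require Import all_classical all_reals all_analysis.
From mathcomp Require Import measurable_realfun ring lra zify.

Set Implicit Arguments.
Unset Strict Implicit.
Unset Printing Implicit Defensive.

Import Order.TTheory GRing.Theory Num.Theory.
Import numFieldNormedType.Exports.

Local Open Scope classical_set_scope.
Local Open Scope ring_scope.

(** The two regimes rest on unrelated estimates.

    Small radii.  Scale the radii by a small t.  Then most edges of the random
    graph meet no other edge, so the expected matching size is close to the
    expected number of edges.  Precisely, discarding every edge that meets
    another one leaves a matching, hence
      (edges) - (pairs of edges with a common end) <= M <= (edges)
    (card_le_max_matching, max_matching_le_cover).
    A ball of radius rho contained in the cube has probability V_k rho^k, and
    balls that stick out have less (uniform_cube_ball2_ge, uniform_cube_ball2_le,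
    by slicing along the coordinates), so the expected number of edges is
    V_k t^k sum_i r_i^k up to a boundary effect of relative size O(n^(-1/k)),
    while the number of pairs of incident edges is O(n t^(2k)), by independence
    of the three points involved given their common end.  So everything reduces
    to sum_i r_i^k - sum_i q_i^k >= g n for a constant g > 0
    (majorizes_sum_exprn).  Majorization and convexity of x^k give a nonnegative
    difference.  The gain comes from the hypothesis on the supports: linearly
    many indices have r_i = 0 and q_i >= a after both vectors are sorted, and at
    each of them the tangent inequality for x^k has slack at least (k-1) a^k.
    This is where k >= 2 is needed.

    Large radii.  A supply node of radius zero is almost surely isolated, so
    mu(t R) is at most the number of positive r_i.  On the other side, cut the
    cube into cells of diameter at most t a n^(-1/k).  Inside a cell every supply
    node with q_i >= a is adjacent to every demand node, so a cell containing S
    such supply nodes and D demand nodes contributes min(S, D) to a matching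
    (max_matching_cells).  A cell holds of the order of t^k points on average and
    the counts deviate from their means by their standard deviation only, so the
    matching misses a fraction O(t^(-k/2)) of the nodes with q_i >= a
    (mu_ge_cells).  As the density of these nodes exceeds that of the positive
    r_i, the vector Q gives the larger matchings for t large.

    Every expectation below is that of a nonnegative variable: error terms are
    moved to the side of the inequality where they are added, so that linearity
    and monotonicity hold without any integrability condition. *)

(** * Maximum matchings of finite bipartite graphs *)

Section matching_bounds.
Local Open Scope nat_scope.
Variables S D : finType.
Implicit Types (G M : {set S * D}).

Lemma is_matchingP G M : reflect
  (M \subset G /\ {in M &, forall e f, (e.1 == f.1) || (e.2 == f.2) -> e = f})
  (is_matching G M).
Proof.
apply: (iffP andP) => -[MG h]; split => //.
  move=> e f eM fM; apply: contraTeq => ef; rewrite negb_or.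
  by move/forall_inP: h => /(_ e eM)/forall_inP/(_ f fM)/implyP; apply.
apply/forall_inP => e eM; apply/forall_inP => f fM; apply/implyP.
by rewrite -negb_or; apply: contra => /(h _ _ eM fM)/eqP.
Qed.

Lemma le_max_matching G M : is_matching G M -> #|M| <= max_matching G.
Proof. by move=> h; exact: (leq_bigmax_cond (F := fun M : {set S * D} => #|M|)). Qed.

Lemma max_matching_ex G : exists2 M, is_matching G M & max_matching G = #|M|.
Proof.
rewrite /max_matching (bigop.bigmax_eq_arg finset.set0) /=; last first.
  by apply/is_matchingP; split=> [|e f]; rewrite ?finset.sub0set ?finset.in_set0.
case: arg_maxnP => [|M mM _]; last by exists M.
by apply/is_matchingP; split=> [|e f]; rewrite ?finset.sub0set ?finset.in_set0.
Qed.

Lemma max_matching_mono G G' : G \subset G' -> max_matching G <= max_matching G'.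
Proof.
move=> GG'; have [M /is_matchingP[MG inj] ->] := max_matching_ex G.
by apply/le_max_matching/is_matchingP; split=> //; exact: fintype.subset_trans MG GG'.
Qed.

(** An edge of a matching either starts in I, and there is at most one for each
node of I, or it is an edge of the graph that starts outside I. *)
Lemma max_matching_le_cover G (I : {set S}) :
  max_matching G <= #|I| + \sum_(e | e.1 \notin I) (e \in G).
Proof.
have [M /is_matchingP[MG inj] ->] := max_matching_ex G.
rewrite -(cardsID [set e | e.1 \in I]%SET M) leq_add//.
  have /card_in_imset <- : {in M :&: [set e | e.1 \in I]%SET &, injective fst}.
    by move=> e f /setIP[eM _] /setIP[fM _] ef; apply: inj => //; rewrite ef eqxx.
  by apply/subset_leq_card/fintype.subsetP => _ /imsetP[e /setIP[_ +] ->]; rewrite inE.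
rewrite -sum1_card big_mkcond [leqRHS]big_mkcond; apply: leq_sum => e _.
rewrite !inE; case: ifP => // /andP[eI eM]; rewrite eI.
by rewrite (fintype.subsetP MG).
Qed.

(** Discarding every edge that meets another edge leaves a matching. *)
Lemma card_le_max_matching G :
  #|G| <= max_matching G
    + \sum_i \sum_j \sum_(j' | j' != j) (((i, j) \in G) && ((i, j') \in G))
    + \sum_j \sum_i \sum_(i' | i' != i) (((i, j) \in G) && ((i', j) \in G)).
Proof.
pose M := [set e in G | [forall f in G, ((e.1 == f.1) || (e.2 == f.2)) ==> (e == f)]]%SET.
have MG : M \subset G by apply/fintype.subsetP => e; rewrite inE => /andP[].
have /le_max_matching : is_matching G M.
  apply/is_matchingP; split=> // e f; rewrite !inE => /andP[eG h] /andP[fG _] ef.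
  by move/forall_inP: h => /(_ f fG)/implyP/(_ ef)/eqP.
rewrite [X in _ -> _ <= _ + X]exchange_big/= !pair_big/= -addnA => Mle.
apply: leq_trans (leq_add Mle (leqnn _)).
rewrite -!sum1_card big_mkcond [X in _ <= X + _]big_mkcond -!big_split/=.
apply: leq_sum => -[i j] _ /=; rewrite inE.
have [eG/=|//] := boolP ((i, j) \in G).
case: ifPn => // /forall_inPn[[i' j'] fG].
rewrite negb_imply/= => /andP[/orP[/eqP ii|/eqP jj] ef].
  rewrite (bigD1 j')/=; first by rewrite ii fG; lia.
  by apply: contraNneq ef => jj; rewrite xpair_eqE ii jj !eqxx.
rewrite [X in _ + (_ + X)](bigD1 i')/=; first by rewrite jj fG; lia.
by apply: contraNneq ef => ii; rewrite xpair_eqE ii jj !eqxx.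
Qed.

(** A matching that is maximal among those made of edges internal to the cells
must, inside each cell, exhaust one of the two sides. *)
Lemma max_matching_cells (C : finType) G (A : C -> {set S}) (B : C -> {set D}) :
  (forall c c' x, x \in A c -> x \in A c' -> c = c') ->
  (forall c c' x, x \in B c -> x \in B c' -> c = c') ->
  (forall c x y, x \in A c -> y \in B c -> (x, y) \in G) ->
  \sum_c minn #|A c| #|B c| <= max_matching G.
Proof.
move=> Adisj Bdisj ABG.
pose G' := [set e | [exists c, (e.1 \in A c) && (e.2 \in B c)]]%SET.
have /max_matching_mono : G' \subset G.
  apply/fintype.subsetP => -[x y]; rewrite inE => /existsP[c /andP[]].
  exact: ABG.
apply: leq_trans; have [M mM Mmax] := max_matching_ex G'; rewrite Mmax.
have /is_matchingP[MG inj] := mM.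
pose Mc c := [set e in M | (e.1 \in A c) && (e.2 \in B c)]%SET.
have -> : #|M| = \sum_c #|Mc c|.
  under [RHS]eq_bigr do rewrite -sum1_card big_mkcond.
  rewrite -sum1_card exchange_big big_mkcond; apply: eq_bigr => e _.
  case: ifPn => eM; last by rewrite big1// => c _; rewrite inE (negbTE eM).
  have := fintype.subsetP MG _ eM; rewrite inE => /existsP[c /andP[e1 e2]].
  rewrite (bigD1 c)//= inE eM e1 e2 big1// => c' c'c; rewrite inE.
  by case: ifP => // /and3P[_ e1' _]; rewrite (Adisj _ _ _ e1 e1') eqxx in c'c.
apply: leq_sum => c _; rewrite geq_min; apply: contraPT (leqnn #|M|).
(* Otherwise the cell has a free node on both sides, and joining the two enlarges
   the matching. *)
rewrite negb_or -!ltnNge => /andP[ltA ltB].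
have [x xA xM] : exists2 x, x \in A c & x \notin [set e.1 | e in Mc c]%SET.
  apply/subsetPn/negP => /subset_leq_card; apply/negP; rewrite -ltnNge.
  exact: leq_ltn_trans (leq_imset_card _ _) ltA.
have [y yB yM] : exists2 y, y \in B c & y \notin [set e.2 | e in Mc c]%SET.
  apply/subsetPn/negP => /subset_leq_card; apply/negP; rewrite -ltnNge.
  exact: leq_ltn_trans (leq_imset_card _ _) ltB.
have xyM e : e \in M -> (e.1 == x) || (e.2 == y) -> False.
  move=> eM; have := fintype.subsetP MG _ eM; rewrite inE => /existsP[c' /andP[e1 e2]].
  move=> /orP[/eqP ex|/eqP ey].
    have ? : c' = c by apply: (Adisj _ _ x) => //; rewrite -ex.
    by subst; move/negP: xM; apply; apply/imsetP; exists e => //; rewrite inE eM e1.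
  have ? : c' = c by apply: (Bdisj _ _ y) => //; rewrite -ey.
  by subst; move/negP: yM; apply; apply/imsetP; exists e => //; rewrite inE eM e1.
have xyNM : (x, y) \notin M by apply/negP => /xyM/=; rewrite eqxx; exact.
have /le_max_matching : is_matching G' ((x, y) |: M).
  apply/is_matchingP; split.
    by rewrite finset.subUset MG finset.sub1set inE andbT; apply/existsP; exists c; rewrite xA.
  move=> e f /setU1P[->|eM] /setU1P[->|fM]//=; last exact: inj.
  - by rewrite [x == _]eq_sym [y == _]eq_sym => /(xyM _ fM).
  - by move/(xyM _ eM).
by rewrite Mmax cardsU1 xyNM add1n ltnn.
Qed.

End matching_bounds.

(** * Power sums of majorized vectors *)

Section majorization_gap.
Variable R : realType.

(** Convexity of the power, by induction: multiplying by x leaves the square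
(k + 1) y^k (x - y)^2. *)
Lemma exprn_tangent_le (k : nat) (x y : R) : 0 <= x -> 0 <= y ->
  y ^+ k.+1 + k.+1%:R * y ^+ k * (x - y) <= x ^+ k.+1.
Proof.
move=> x0 y0; elim: k => [|k IH]; first by rewrite !expr1 expr0; lra.
rewrite [leRHS]exprS; apply: le_trans (ler_wpM2l x0 IH).
rewrite -subr_ge0 [leRHS](_ : _ = k.+1%:R * y ^+ k * (x - y) ^+ 2).
  by rewrite mulr_ge0 ?sqr_ge0// mulr_ge0 ?exprn_ge0.
by rewrite -[k.+2%:R]natr1 !exprS; ring.
Qed.

(** Summation by parts: the sum dominates the last weight times the last
partial sum. *)
Lemma sumr_nonincr_weight_ge0 (n : nat) (w d : nat -> R) :
  (forall i, 0 <= w i) -> (forall i, (i.+1 < n)%N -> w i.+1 <= w i) ->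
  (forall l, (l <= n)%N -> 0 <= \sum_(i < l) d i) ->
  0 <= \sum_(i < n) w i * d i.
Proof.
case: n => [|n] w0 wd D0; first by rewrite big_ord0.
suff H m : (m <= n)%N -> w m * \sum_(i < m.+1) d i <= \sum_(i < m.+1) w i * d i.
  by apply: le_trans (H n (leqnn _)); rewrite mulr_ge0// D0.
elim: m => [|m IH] mn; first by rewrite !big_ord1.
rewrite big_ord_recr/= [leRHS]big_ord_recr/= mulrDr lerD2r.
apply: le_trans (IH (ltnW mn)).
by rewrite ler_wpM2r// ?wd// D0// ltnS ltnW.
Qed.

Let big_decreasing_rearrangement n (x : 'rV[R]_n) (V : nmodType) (f : R -> V) :
  \sum_(i < n) f (decreasing_rearrangement x)`_i = \sum_(i < n) f (x ord0 i).
Proof.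
have sz : size (decreasing_rearrangement x) = n.
  by rewrite size_sort size_map size_enum_ord.
transitivity (\sum_(z <- decreasing_rearrangement x) f z).
  by rewrite (big_nth 0) sz big_mkord.
rewrite (perm_big [seq x ord0 i | i <- enum 'I_n]) ?perm_sort//.
by rewrite big_map big_enum.
Qed.

(** An index at which x vanishes and y is at least a contributes the gap
between the power and its tangent line at y, taken at 0; at the other indices
convexity is enough.  The first-order terms sum to a nonnegative number because
the slopes of the tangents decrease along the rearrangement of y. *)
Lemma majorizes_sum_exprn (n k : nat) (x y : 'rV[R]_n) (a : R) :
  majorizes x y -> (forall i, 0 <= x ord0 i) -> (forall i, 0 <= y ord0 i) ->
  0 <= a ->
  \sum_(i < n) y ord0 i ^+ k.+1
    + k%:R * a ^+ k.+1 * (#|[set i | a <= y ord0 i]%SET|%:R - #|[set i | 0 < x ord0 i]%SET|%:R)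
  <= \sum_(i < n) x ord0 i ^+ k.+1.
Proof.
move=> [maj tot] x0 y0 a0.
set u := decreasing_rearrangement x; set v := decreasing_rearrangement y.
have nth0 (z : 'rV[R]_n) i : (forall i, 0 <= z ord0 i) ->
    0 <= (decreasing_rearrangement z)`_i.
  move=> z0; have [isz|] := ltnP i (size (decreasing_rearrangement z)); last first.
    by move=> ?; rewrite nth_default.
  have : (decreasing_rearrangement z)`_i \in decreasing_rearrangement z by exact: mem_nth.
  by rewrite mem_sort => /mapP[j _ ->].
have szv : size v = n by rewrite size_sort size_map size_enum_ord.
have cardE (P : pred R) (z : 'rV[R]_n) : #|[set i | P (z ord0 i)]%SET|%:R =
    \sum_(i < n) (P (decreasing_rearrangement z)`_i)%:R :> R.
  rewrite (big_decreasing_rearrangement z (fun t => (P t)%:R)).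
  rewrite -sum1_card natr_sum big_mkcond; apply: eq_bigr => i _.
  by rewrite inE; case: (P _).
rewrite (cardE (fun t => a <= t)) (cardE (fun t => 0 < t)).
rewrite -(big_decreasing_rearrangement x (fun t => t ^+ k.+1)).
rewrite -(big_decreasing_rearrangement y (fun t => t ^+ k.+1)).
rewrite -/u -/v -sumrB mulr_sumr -big_split/=.
have W : 0 <= \sum_(i < n) (k.+1%:R * v`_i ^+ k) * (u`_i - v`_i).
  apply: (sumr_nonincr_weight_ge0 (w := fun i => k.+1%:R * v`_i ^+ k)
     (d := fun i => u`_i - v`_i)).
  - by move=> i; rewrite mulr_ge0// exprn_ge0// nth0.
  - move=> i i1n; rewrite ler_wpM2l// lerXn2r ?nnegrE ?nth0//.
    have /sortedP : sorted >=%R v by apply: sort_sorted => s t; exact: le_total.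
    by move=> /(_ 0 i); rewrite szv; apply.
  - move=> l; rewrite leq_eqVlt => /predU1P[->|ln]; rewrite sumrB subr_ge0.
      have E := big_decreasing_rearrangement _ (fun t => t).
      by rewrite !E tot.
    by case: l ln => [|l] ln; [rewrite !big_ord0|exact: maj].
apply: (@le_trans _ _ (\sum_(i < n) (u`_i ^+ k.+1 - (k.+1%:R * v`_i ^+ k) * (u`_i - v`_i)))).
  apply: ler_sum => i _.
  have ui0 : 0 <= u`_i by exact: nth0.
  have vi0 : 0 <= v`_i by exact: nth0.
  have ka : 0 <= k%:R * a ^+ k.+1 by rewrite mulr_ge0// exprn_ge0.
  have T := exprn_tangent_le k ui0 vi0.
  have [ui|] := ltP 0 u`_i.
    apply: (@le_trans _ _ (v`_i ^+ k.+1)); last by lra.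
    by rewrite gerDl mulr_ge0_le0// subr_le0; case: (a <= _).
  move=> ui; move: T; have {ui0 ui} -> : u`_i = 0 by apply/eqP; rewrite eq_le ui ui0.
  move=> T.
  have [av|_] := leP a v`_i; last first.
    by rewrite subrr mulr0 addr0; lra.
  have : k%:R * a ^+ k.+1 <= k%:R * v`_i ^+ k.+1.
    by rewrite ler_wpM2l// lerXn2r ?nnegrE.
  rewrite subr0 mulr1 expr0n/= !sub0r mulrN opprK -mulrA -exprSr -natr1.
  by lra.
by rewrite sumrB gerBl.
Qed.

End majorization_gap.

(** * Volume of Euclidean balls by slicing *)

Section ball_volume.
Variable R : realType.
Local Notation leb := (@lebesgue_measure R).

(** The slice at height z of a Euclidean ball of radius rho is a ball of this
radius, one dimension below. *)
Definition chord (rho z : R) : R := Num.sqrt (rho ^+ 2 - z ^+ 2).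

Lemma continuous_chord_exprn k rho x :
  continuous (fun y : R => chord rho (x - y) ^+ k).
Proof.
move=> y; apply: (@cvg_comp _ _ _ _ (fun z : R => z ^+ k)); last exact: exprn_continuous.
apply: (@cvg_comp _ _ _ _ (@Num.sqrt R)); last exact: sqrt_continuous.
apply: cvgB; first exact: cvg_cst.
apply: (@cvg_comp _ _ _ _ (fun z : R => z ^+ 2)); last exact: exprn_continuous.
by apply: cvgB; [exact: cvg_cst|exact: cvg_id].
Qed.

Lemma measurable_chord_exprn k rho x (D : set (measurableTypeR R)) :
  measurable_fun D (fun y => (chord rho (x - y) ^+ k)%:E).
Proof.
have m : measurable_fun (setT : set (measurableTypeR R))
    (fun y : R => chord rho (x - y) ^+ k).
  by apply: continuous_measurable_fun; exact: continuous_chord_exprn.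
by apply/measurable_EFinP; exact: measurable_funTS m.
Qed.

(** The ratio of the volumes of the unit balls of dimensions k + 1 and k. *)
Definition slice_volume (k : nat) : R :=
  fine (\int[leb]_(w in `[(-1)%R, 1%R]) (chord 1 (0 - w) ^+ k)%:E)%E.

Lemma slice_volumeE k :
  (\int[leb]_(w in `[(-1)%R, 1%R]) (chord 1 (0 - w) ^+ k)%:E = (slice_volume k)%:E)%E.
Proof.
rewrite fineK// ge0_fin_numE; last first.
  by apply: integral_ge0 => w _; rewrite lee_fin exprn_ge0// sqrtr_ge0.
apply: (@le_lt_trans _ _ (\int[leb]_(w in `[(-1)%R, 1%R]) (cst 1%:E) w)%E).
  apply: ge0_le_integral => //.
  - by move=> w _; rewrite lee_fin exprn_ge0// sqrtr_ge0.
  - exact: measurable_chord_exprn.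
  - move=> w _; rewrite lee_fin exprn_ile1// ?sqrtr_ge0//.
    rewrite -[leRHS]sqrtr1 ler_wsqrtr// expr1n gerBl; exact: sqr_ge0.
rewrite integral_cst//= lebesgue_measure_itv/= lte_fin.
by case: ifP => _; rewrite ?mule0 ?mul1e// -EFinB ltry.
Qed.

Lemma slice_volume_gt0 k : 0 < slice_volume k.
Proof.
rewrite -lte_fin -slice_volumeE.
apply: (@lt_le_trans _ _ (\int[leb]_(w in `[0%R, 2^-1%R]) (cst (2^-1 ^+ k)%:E) w)%E).
  rewrite integral_cst//= lebesgue_measure_itv/= lte_fin invr_gt0 ltr0n/=.
  by rewrite -EFinB -EFinM lte_fin subr0 mulr_gt0// ?exprn_gt0 ?invr_gt0.
apply: (@le_trans _ _ (\int[leb]_(w in `[0%R, 2^-1%R]) (chord 1 (0 - w) ^+ k)%:E)%E).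
  apply: ge0_le_integral => //.
  - by move=> w _; rewrite lee_fin exprn_ge0// invr_ge0.
  - exact: measurable_chord_exprn.
  - move=> w /=; rewrite in_itv/= => /andP[w0 w1].
    rewrite lee_fin lerXn2r ?nnegrE ?sqrtr_ge0// /chord sub0r sqrrN expr1n.
    rewrite -[leLHS]ger0_norm// -sqrtr_sqr ler_wsqrtr//.
    by nra.
apply: ge0_subset_integral => //.
- exact: measurable_chord_exprn.
- by move=> w _; rewrite lee_fin exprn_ge0// sqrtr_ge0.
- by move=> w /=; rewrite !in_itv/= => /andP[w0 w1]; lra.
Qed.

(** Homogeneity of volume, reduced to the substitution y = x + rho w in a single
variable. *)
Lemma integral_chord_exprn k rho x : 0 <= rho ->
  (\int[leb]_(y in `[(x - rho)%R, (x + rho)%R]) (chord rho (x - y) ^+ k)%:E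
   = (slice_volume k * rho ^+ k.+1)%:E)%E.
Proof.
rewrite le_eqVlt => /predU1P[<-|rho0].
  by rewrite subr0 addr0 set_itv1 integral_set1 expr0n mulr0.
pose F (w : R) := x + rho * w.
have dF (w : R) : is_derive w 1 F rho.
  rewrite (_ : F = cst x + rho *: id); last by apply/funext.
  have D := is_deriveD (is_derive_cst x w 1) (is_deriveZ rho (is_derive_id w (1 : R))).
  by rewrite add0r [rho *: 1]mulr1 in D.
have F' : derive1 F = cst rho.
  by apply/funext => w; rewrite derive1E; exact: derive_val.
have cF : continuous F.
  move=> w; apply: differentiable_continuous; apply/derivable1_diffP.
  exact: ex_derive.
have -> : x - rho = F (-1) by rewrite /F mulrN1.
have -> : x + rho = F 1 by rewrite /F mulr1.
rewrite integration_by_substitution_increasing//; last first.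
- by apply: continuous_subspaceT => y; exact: continuous_chord_exprn.
- split.
  + by move=> w _; exact: ex_derive.
  + exact/cvg_at_right_filter/cF.
  + exact/cvg_at_left_filter/cF.
- by rewrite F'; exact: is_cvg_cst.
- by rewrite F'; exact: is_cvg_cst.
- by rewrite F' => w _; exact: cst_continuous.
- by move=> u v _ _ uv; rewrite /F ltrD2l ltr_pM2l.
transitivity (\int[leb]_(w in `[(-1)%R, 1%R])
    ((rho ^+ k.+1)%:E * (chord 1 (0 - w) ^+ k)%:E))%E.
  apply: eq_integral => w _; rewrite F' -EFinM; congr EFin => /=.
  rewrite /F [RHS]mulrC exprSr mulrA -exprMn; congr (_ ^+ _ * _).
  rewrite /chord -[X in _ = _ * X](ger0_norm (ltW rho0)) -sqrtr_sqr.
  by rewrite [RHS]mulrC -sqrtrM ?sqr_ge0//; congr Num.sqrt; ring.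
rewrite ge0_integralZl_EFin//; last 3 first.
- by move=> w _; rewrite lee_fin exprn_ge0// sqrtr_ge0.
- exact: measurable_chord_exprn.
- by rewrite exprn_ge0// ltW.
by rewrite slice_volumeE -EFinM mulrC.
Qed.

End ball_volume.

(** * Balls under the uniform law of the cube *)

Section ball_probability.
Variable R : realType.
Local Notation leb := (@lebesgue_measure R).
Local Notation U := (uniform_prob (@ltr01 R)).

Lemma measurable_dist2 d (T : measurableType d) (k : nat)
    (f g : T -> k.-tuple (measurableTypeR R)) :
  measurable_fun setT f -> measurable_fun setT g ->
  measurable_fun setT (fun z => dist2 (f z) (g z)).
Proof.
move=> mf mg; rewrite /dist2.
apply: (@measurableT_comp _ _ _ _ _ _ (@Num.sqrt R)).
  by apply: continuous_measurable_fun; exact: sqrt_continuous.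
apply: measurable_sum => i; apply: measurable_funX; apply: measurable_funB.
- exact: (measurableT_comp (measurable_tnth i) mf).
- exact: (measurableT_comp (measurable_tnth i) mg).
Qed.

Lemma measurable_dist2_le d (T : measurableType d) (k : nat)
    (f g : T -> k.-tuple (measurableTypeR R)) (rho : R) :
  measurable_fun setT f -> measurable_fun setT g ->
  measurable [set z | dist2 (f z) (g z) <= rho].
Proof.
move=> mf mg; have := measurable_dist2 mf mg measurableT (measurable_itv `]-oo, rho]).
by rewrite setTI.
Qed.

Lemma measurable_ball2 (k : nat) (s : k.-tuple R) (rho : R) :
  measurable [set d : k.-tuple (measurableTypeR R) | dist2 s d <= rho].
Proof.
have mc : measurable_fun setT
    (cst s : k.-tuple (measurableTypeR R) -> k.-tuple (measurableTypeR R)).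
  exact: measurable_cst.
exact: (measurable_dist2_le rho mc (@measurable_id _ _ setT)).
Qed.

Lemma dist2_le (k : nat) (s d : k.-tuple R) (rho : R) : 0 <= rho ->
  (dist2 s d <= rho) = (\sum_(i < k) (tnth s i - tnth d i) ^+ 2 <= rho ^+ 2).
Proof.
move=> rho0; rewrite /dist2 -[X in _ <= X](ger0_norm rho0) -sqrtr_sqr.
by rewrite ler_sqrt// sqr_ge0.
Qed.

(** Slicing a ball along the first coordinate. *)
Lemma dist2_cons_le (k : nat) (x y rho : R) (s d : k.-tuple R) : 0 <= rho ->
  (dist2 [tuple of x :: s] [tuple of y :: d] <= rho) =
  (x - rho <= y <= x + rho) && (dist2 s d <= chord rho (x - y)).
Proof.
move=> rho0; rewrite !dist2_le ?sqrtr_ge0// big_ord_recl/=.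
under eq_bigr do rewrite !tnthS.
set S := \sum_(i < k) _; have S0 : 0 <= S by apply: sumr_ge0 => i _; exact: sqr_ge0.
have -> : tnth [tuple of x :: s] ord0 = x by [].
have -> : tnth [tuple of y :: d] ord0 = y by [].
have [/andP[h1 h2]|h]/= := boolP (x - rho <= y <= x + rho).
  by rewrite /chord sqr_sqrtr ?lerBrDl//; nra.
apply/negbTE; rewrite -ltNge; move: h; rewrite negb_and -!ltNge => /orP[h|h]; nra.
Qed.

Lemma uniform_cubeS (k : nat) (A : set (k.+1.-tuple (measurableTypeR R))) :
  uniform_cube R k.+1 A =
  (\int[U]_y uniform_cube R k [set d : k.-tuple (measurableTypeR R) | A [tuple of y :: d]])%E.
Proof.
rewrite /uniform_cube /= /distribution /pushforward /= /product_measure1.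
by apply: eq_integral => y _ /=; rewrite xsectionE.
Qed.

Definition ball_volume (k : nat) : R := \prod_(j < k) slice_volume R j.

Lemma ball_volume_gt0 k : 0 < ball_volume k.
Proof. by apply: prodr_gt0 => j _; exact: slice_volume_gt0. Qed.

Let slice (k : nat) (x rho : R) : measurableTypeR R -> \bar R :=
  (fun y : measurableTypeR R => (ball_volume k * chord rho (x - y) ^+ k)%:E) \_ `[x - rho, x + rho].

Let measurable_slice_in k x rho (D : set (measurableTypeR R)) :
  measurable_fun D (fun y => (ball_volume k * chord rho (x - y) ^+ k)%:E).
Proof.
under eq_fun do rewrite EFinM.
by apply: measurable_funeM; exact: measurable_chord_exprn.
Qed.

Let slice_ge0_in k (x rho y : R) : (0 <= (ball_volume k * chord rho (x - y) ^+ k)%:E)%E.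
Proof. by rewrite lee_fin mulr_ge0// ?exprn_ge0 ?sqrtr_ge0// ltW ?ball_volume_gt0. Qed.

Let measurable_slice k (x rho : R) : measurable_fun setT (slice k x rho).
Proof.
have mI : measurable (`[x - rho, x + rho]%classic : set (measurableTypeR R)).
  exact: measurable_itv.
exact: ((measurable_restrictT _ mI).1 (@measurable_slice_in k x rho _)).
Qed.

Let slice_ge0 k (x rho y : R) : (0 <= slice k x rho y)%E.
Proof. by rewrite /slice; apply: erestrict_ge0 => z _; exact: slice_ge0_in. Qed.

Let integral_slice_in k (x rho : R) : 0 <= rho ->
  (\int[leb]_(y in `[(x - rho)%R, (x + rho)%R])
     (ball_volume k * chord rho (x - y) ^+ k)%:E
   = (ball_volume k.+1 * rho ^+ k.+1)%:E)%E.
Proof.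
move=> rho0; under eq_integral do rewrite EFinM.
rewrite ge0_integralZl_EFin//.
- by rewrite integral_chord_exprn// -EFinM /ball_volume big_ord_recr/= mulrA.
- by move=> y _; rewrite lee_fin exprn_ge0// sqrtr_ge0.
- exact: measurable_chord_exprn.
- by rewrite ltW// ball_volume_gt0.
Qed.

Let integral_slice_le k (x rho : R) : 0 <= rho ->
  (\int[U]_y slice k x rho y <= (ball_volume k.+1 * rho ^+ k.+1)%:E)%E.
Proof.
move=> rho0; rewrite integral_uniform// subr0 invr1 mul1e -integral_mkcondr.
rewrite -(@integral_slice_in k x)//; apply: ge0_subset_integral => //.
exact: measurableI.
Qed.

Let integral_slice k (x rho : R) : 0 <= rho -> rho <= x <= 1 - rho ->
  (\int[U]_y slice k x rho y = (ball_volume k.+1 * rho ^+ k.+1)%:E)%E.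
Proof.
move=> rho0 /andP[h1 h2]; rewrite integral_uniform// subr0 invr1 mul1e.
rewrite -integral_mkcondr setIidr ?integral_slice_in//.
by move=> y /=; rewrite !in_itv/=; lra.
Qed.

Let measurable_ball2_section k (s : k.+1.-tuple R) (rho : R) :
  measurable_fun setT (fun y : measurableTypeR R =>
    uniform_cube R k [set d : k.-tuple (measurableTypeR R) | dist2 s [tuple of y :: d] <= rho]).
Proof.
pose A := @tuple_cons _ (measurableTypeR R) k @^-1` [set d | dist2 s d <= rho].
rewrite (_ : (fun _ => _) = uniform_cube R k \o xsection A); last first.
  by apply/funext => y /=; rewrite xsectionE.
apply: measurable_fun_xsection.
rewrite -[X in measurable X]setTI; apply: measurable_tuple_cons => //.
exact: measurable_ball2.
Qed.

Let uniform_cube0_le (x : 0.-tuple R) (rho : R) : 0 <= rho ->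
  uniform_cube R 0 [set d | dist2 x d <= rho] = 1%E.
Proof.
move=> rho0; rewrite /uniform_cube/= diracE mem_set//=.
by rewrite dist2_le// big_ord0 sqr_ge0.
Qed.

Let ball2_section k (x y rho : R) (s : k.-tuple R) : 0 <= rho ->
  y \in `[x - rho, x + rho]%classic ->
  [set d : k.-tuple R | dist2 [tuple of x :: s] [tuple of y :: d] <= rho] =
  [set d | dist2 s d <= chord rho (x - y)].
Proof.
move=> rho0; rewrite inE/= in_itv/= => xy.
by apply/seteqP; split=> d /=; rewrite dist2_cons_le// xy.
Qed.

(** The density of the uniform law is at most 1, so no position of the center gives
a ball more than its volume; in the induction, the slice of the cube at height y
sees a ball of radius chord rho (x - y). *)
Lemma uniform_cube_ball2_le k (s : k.-tuple R) (rho : R) : 0 <= rho ->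
  (uniform_cube R k [set d | (dist2 s d <= rho)%R] <= (ball_volume k * rho ^+ k)%:E)%E.
Proof.
elim: k => [|k IH] in s rho * => rho0.
  by rewrite uniform_cube0_le// /ball_volume big_ord0 expr0 mulr1.
rewrite uniform_cubeS; case/tupleP: s => x s.
apply: le_trans (integral_slice_le k x rho0).
apply: ge0_le_integral => //.
  exact: (measurable_ball2_section [tuple of x :: s] rho).
move=> y _; rewrite /slice patchE; case: ifPn => xy.
  by rewrite (ball2_section s rho0 xy); apply: IH; exact: sqrtr_ge0.
rewrite [X in uniform_cube _ _ X](_ : _ = set0) ?measure0//.
apply/seteqP; split=> // d /=; rewrite dist2_cons_le// => /andP[h _].
by move: xy; rewrite notin_setE/= in_itv/= h.
Qed.

(** The ball is contained in the cube, hence so are its slices, whose radii are at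
most rho. *)
Lemma uniform_cube_ball2_ge k (s : k.-tuple R) (rho : R) : 0 <= rho ->
  (forall i, rho <= tnth s i <= 1 - rho) ->
  ((ball_volume k * rho ^+ k)%:E <= uniform_cube R k [set d | (dist2 s d <= rho)%R])%E.
Proof.
elim: k => [|k IH] in s rho * => rho0 srho.
  by rewrite uniform_cube0_le// /ball_volume big_ord0 expr0 mulr1.
rewrite uniform_cubeS; case/tupleP: s srho => x s srho.
rewrite -(@integral_slice k x rho rho0); last exact: (srho ord0).
apply: ge0_le_integral => //.
  exact: (measurable_ball2_section [tuple of x :: s] rho).
move=> y _; rewrite /slice patchE; case: ifPn => xy; last exact: measure_ge0.
have cle : chord rho (x - y) <= rho.
  rewrite -[leRHS](ger0_norm rho0) -sqrtr_sqr ler_wsqrtr// gerBl; exact: sqr_ge0.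
apply: le_trans (IH s (chord rho (x - y)) (sqrtr_ge0 _) _) _.
  by move=> i; have := srho (lift ord0 i); rewrite tnthS; lra.
by rewrite (ball2_section s rho0 xy).
Qed.

End ball_probability.

(** * Expectations of nonnegative variables *)

Section nonnegative_expectation.
Local Open Scope ereal_scope.
Context d (T : measurableType d) (R : realType) (P : probability T R).

Lemma expectation_ge0_le (f g : T -> R) :
  measurable_fun setT f -> measurable_fun setT g ->
  (forall w, 0 <= f w)%R -> (forall w, f w <= g w)%R -> 'E_P[f] <= 'E_P[g].
Proof.
move=> mf mg f0 fg; rewrite unlock; apply: ge0_le_integral => //.
- by move=> w _; rewrite lee_fin.
- exact/measurable_EFinP.
- exact/measurable_EFinP.
- by move=> w _; rewrite lee_fin.
Qed.

Lemma expectation_ge0D (f g : T -> R) :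
  measurable_fun setT f -> measurable_fun setT g ->
  (forall w, 0 <= f w)%R -> (forall w, 0 <= g w)%R ->
  'E_P[fun w => (f w + g w)%R] = 'E_P[f] + 'E_P[g].
Proof.
move=> mf mg f0 g0; rewrite unlock; under eq_integral do rewrite EFinD.
rewrite ge0_integralD//.
- by move=> w _; rewrite lee_fin.
- exact/measurable_EFinP.
- by move=> w _; rewrite lee_fin.
- exact/measurable_EFinP.
Qed.

Lemma expectation_ge0Zl (c : R) (f : T -> R) : (0 <= c)%R ->
  measurable_fun setT f -> (forall w, 0 <= f w)%R ->
  'E_P[fun w => (c * f w)%R] = c%:E * 'E_P[f].
Proof.
move=> c0 mf f0; rewrite unlock; under eq_integral do rewrite EFinM.
rewrite ge0_integralZl_EFin//.
- by move=> w _; rewrite lee_fin.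
- exact/measurable_EFinP.
Qed.

Lemma measurable_sum_cond (I : Type) (s : seq I) (Q : pred I) (f : I -> T -> R) :
  (forall i, measurable_fun setT (f i)) ->
  measurable_fun setT (fun w => (\sum_(i <- s | Q i) f i w)%R).
Proof.
move=> mf; rewrite (_ : (fun _ => _) = fun w => (\sum_(i <- [seq i <- s | Q i]) f i w)%R).
  exact: measurable_sum.
by apply/funext => w; rewrite big_filter.
Qed.

Lemma expectation_ge0_sum (I : Type) (s : seq I) (Q : pred I) (f : I -> T -> R) :
  (forall i, measurable_fun setT (f i)) -> (forall i w, 0 <= f i w)%R ->
  'E_P[fun w => (\sum_(i <- s | Q i) f i w)%R] = \sum_(i <- s | Q i) 'E_P[f i].
Proof.
move=> mf f0; rewrite unlock -big_filter.
under eq_integral => w _ do rewrite -big_filter -sumEFin.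
rewrite ge0_integral_sum//.
- by move=> i; exact/measurable_EFinP.
- by move=> i w _; rewrite lee_fin.
Qed.

Lemma bool_indic (b : T -> bool) :
  (fun w => (b w)%:R : R) = \1_[set w | b w].
Proof.
apply/funext => w; rewrite indicE; congr (nat_of_bool _)%:R.
by apply/idP/idP; rewrite inE.
Qed.

Lemma measurable_natr_bool (b : T -> bool) : measurable [set w | b w] ->
  measurable_fun setT (fun w => (b w)%:R : R).
Proof. by move=> mb; rewrite bool_indic; exact: measurable_indic. Qed.

Lemma expectation_bool (b : T -> bool) : measurable [set w | b w] ->
  'E_P[fun w => (b w)%:R] = P [set w | b w].
Proof. by move=> mb; rewrite bool_indic; exact: expectation_indic. Qed.

(** The variance of a sum S of pairwise independent indicators is at most its mean.
It is read off from (S - N p)^2 + 2 N p S = S^2 + (N p)^2, where both sides are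
sums of nonnegative variables. *)
Lemma expectation_count_sqr_le (I : finType) (A : {set I}) (b : I -> T -> bool) (p : R) :
  (forall i, measurable [set w | b i w]) ->
  (forall i, P [set w | b i w] = p%:E) ->
  (forall i j, i != j -> P [set w | b i w && b j w] = (p ^+ 2)%:E) ->
  'E_P[fun w => ((\sum_(i in A) (b i w)%:R - #|A|%:R * p) ^+ 2)%R]
    <= (#|A|%:R * p)%:E.
Proof.
move=> mb Pb Pbb.
have [->|[i0 i0A]] := set_0Vmem A.
  rewrite cards0 mul0r; under [X in 'E_P[X]]eq_fun do rewrite big_set0 subrr expr0n/=.
  by rewrite (expectation_cst P 0).
have p0 : (0 <= p)%R by rewrite -lee_fin -(Pb i0).
pose S w : R := (\sum_(i in A) (b i w)%:R)%R.
have mS : measurable_fun setT S.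
  by apply: measurable_sum_cond => i; exact: measurable_natr_bool.
have S0 w : (0 <= S w)%R by apply: sumr_ge0.
set N : R := #|A|%:R; set q := fun w => _.
have mbb i j : measurable [set w | b i w && b j w].
  rewrite (_ : mkset _ = [set w | b i w] `&` [set w | b j w]); first exact: measurableI.
  by apply/seteqP; split=> w /= /andP.
have ES : 'E_P[S] = (N * p)%:E.
  rewrite /S expectation_ge0_sum//; last by move=> i; exact: measurable_natr_bool.
  under eq_bigr do rewrite expectation_bool// Pb.
  by rewrite sumEFin sumr_const mulr_natl.
have mSS : measurable_fun setT (fun w => S w ^+ 2)%R by exact: measurable_funX.
have ESS : 'E_P[fun w => (S w ^+ 2)%R] = (N * p + N * (N - 1) * p ^+ 2)%:E.
  have -> : (fun w => (S w ^+ 2)%R) =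
      (fun w => (\sum_(i in A) \sum_(j in A) (b i w && b j w)%:R)%R).
    apply/funext => w; rewrite expr2 /S mulr_suml; apply: eq_bigr => i _.
    by rewrite mulr_sumr; apply: eq_bigr => j _; rewrite -natrM mulnb.
  rewrite expectation_ge0_sum; last 2 first.
  - by move=> i; apply: measurable_sum_cond => j; exact: measurable_natr_bool.
  - by move=> i w; apply: sumr_ge0.
  transitivity (\sum_(i in A) (p + (N - 1) * p ^+ 2)%:E).
    apply: eq_bigr => i iA; rewrite expectation_ge0_sum//; last first.
      by move=> j; exact: measurable_natr_bool.
    rewrite (bigD1 i)//= expectation_bool// (_ : [set w | _] = [set w | b i w]); last first.
      by apply/seteqP; split=> w /=; rewrite andbb.
    rewrite Pb; under eq_bigr => j /andP[_ ji].
      rewrite expectation_bool// Pbb 1?eq_sym//; over.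
    rewrite sumEFin -EFinD; congr (_ + _)%:E.
    rewrite (eq_bigl (mem (A :\ i)%SET)); last by move=> j; rewrite !inE andbC.
    have -> : N = (1 + #|(A :\ i)%SET|%:R)%R by rewrite /N (cardsD1 i A) iA natrD.
    by rewrite sumr_const addrAC subrr add0r mulr_natl.
  by rewrite sumEFin sumr_const -mulr_natl; congr EFin; rewrite -/N; ring.
have : 'E_P[q] + (2 * N * p)%:E * 'E_P[S] =
    'E_P[fun w => (S w ^+ 2)%R] + ((N * p) ^+ 2)%:E.
  rewrite -expectation_ge0Zl//; last by rewrite !mulr_ge0 ?ler0n.
  rewrite -(expectation_cst P ((N * p) ^+ 2)) -!expectation_ge0D//.
  - congr ('E_P[_]); apply/funext => w; rewrite /q -/(S w) /cst; ring.
  - by move=> w; exact: sqr_ge0.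
  - by move=> w; exact: sqr_ge0.
  - by apply: measurable_funX; apply: measurable_funB.
  - by apply: measurable_funM.
  - by move=> w; exact: sqr_ge0.
  - by move=> w; rewrite !mulr_ge0 ?ler0n.
rewrite ES ESS -EFinM -EFinD.
case: ('E_P[q]) => [e| |]//= -[eq_e].
have : (0 <= N * p ^+ 2)%R by rewrite mulr_ge0 ?sqr_ge0// ler0n.
by rewrite lee_fin; lra.
Qed.

End nonnegative_expectation.

(** * Marginals of independent samples and sections of product laws *)

Section iid_marginals.
Local Open Scope ereal_scope.
Context d (T : measurableType d) (R : realType) (P : probability T R).

Lemma iid_marginal n (i : 'I_n) (A : set T) : measurable A ->
  iid P n [set x | A (tnth x i)] = P A.
Proof.
move=> mA; pose B j := if j == i then A else setT.
rewrite (_ : mkset _ = [set x | forall j, B j (tnth x j)]); last first.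
  apply/seteqP; split=> x /=; last by move=> /(_ i); rewrite /B eqxx.
  by move=> Ax j; rewrite /B; case: eqP => // ->.
rewrite iid_cylinder => [|j]; last by rewrite /B; case: ifP.
rewrite (bigD1 i)//= /B eqxx big1 ?mule1// => j /negbTE ->.
exact: probability_setT.
Qed.

Lemma iid_marginal2 n (i i' : 'I_n) (A A' : set T) : i != i' ->
  measurable A -> measurable A' ->
  iid P n [set x | A (tnth x i) /\ A' (tnth x i')] = P A * P A'.
Proof.
move=> ii' mA mA'.
pose B j := if j == i then A else if j == i' then A' else setT.
rewrite (_ : mkset _ = [set x | forall j, B j (tnth x j)]); last first.
  apply/seteqP; split=> x /=.
    by move=> [Ax Ax'] j; rewrite /B; case: eqP => [->//|_]; case: eqP => // ->.
  move=> h; split; first by have := h i; rewrite /B eqxx.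
  by have := h i'; rewrite /B eqxx eq_sym (negbTE ii').
rewrite iid_cylinder => [|j]; last by rewrite /B; do 2 case: ifP => //.
rewrite (bigD1 i)//= (bigD1 i')/=; last by rewrite eq_sym.
rewrite /B !eqxx eq_sym (negbTE ii') big1 ?mule1// => j /andP[/negbTE -> /negbTE ->].
exact: probability_setT.
Qed.

End iid_marginals.

Section product_sections.
Local Open Scope ereal_scope.
Context d1 d2 (T1 : measurableType d1) (T2 : measurableType d2) (R : realType).
Variables (P1 : probability T1 R) (P2 : probability T2 R).

Lemma product_xsection_le (A : set (T1 * T2)) (c : \bar R) : measurable A ->
  (forall x, P2 [set y | A (x, y)] <= c) -> (P1 \x P2) A <= c.
Proof.
move=> mA Ac; have c0 : 0 <= c by apply: le_trans (measure_ge0 _ _) (Ac point).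
apply: (@le_trans _ _ (\int[P1]_x (cst c x))).
  apply: ge0_le_integral => //; first exact: measurable_fun_xsection.
  by move=> x _ /=; rewrite xsectionE; exact: Ac.
by rewrite integral_cst//= probability_setT mule1.
Qed.

Lemma product_ysection_le (A : set (T1 * T2)) (c : \bar R) : measurable A ->
  (forall y, P1 [set x | A (x, y)] <= c) -> (P1 \x P2) A <= c.
Proof.
move=> mA Ac; have c0 : 0 <= c by apply: le_trans (measure_ge0 _ _) (Ac point).
have -> : (P1 \x P2) A = (P1 \x^ P2) A.
  by apply: product_measure_unique => // ? ? ? ?; rewrite /= product_measure2E.
apply: (@le_trans _ _ (\int[P2]_y (cst c y))).
  apply: ge0_le_integral => //; first exact: measurable_fun_ysection.
  by move=> y _ /=; rewrite ysectionE; exact: Ac.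
by rewrite integral_cst//= probability_setT mule1.
Qed.

Lemma product_xsection_ge (A : set (T1 * T2)) (B : set T1) (c : R) :
  (0 <= c)%R -> measurable A -> measurable B ->
  (forall x, B x -> c%:E <= P2 [set y | A (x, y)]) -> c%:E * P1 B <= (P1 \x P2) A.
Proof.
move=> c0 mA mB Ac.
rewrite -[B in X in X <= _]setIT -integral_indic// -ge0_integralZl_EFin//; last first.
  by apply/measurable_EFinP; exact: measurable_indic.
apply: ge0_le_integral => //.
- by move=> x _; rewrite -EFinM lee_fin mulr_ge0.
- apply: measurable_funeM; apply/measurable_EFinP; exact: measurable_indic.
- exact: measurable_fun_xsection.
- move=> x _ /=; rewrite xsectionE indicE; case: (boolP (x \in B)) => [/set_mem Bx|_].
    by rewrite mule1; exact: Ac.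
  by rewrite mule0 measure_ge0.
Qed.

End product_sections.

(** * Probabilities of edges and of pairs of edges *)

Section edge_probabilities.
Local Open Scope ereal_scope.
Variable R : realType.
Local Notation U := (uniform_prob (@ltr01 R)).
Local Notation V := (ball_volume R).

Lemma uniform_prob01E (A : set (measurableTypeR R)) : measurable A ->
  A `<=` `[0%R, 1%R] -> U A = lebesgue_measure A.
Proof.
move=> mA A01; rewrite -[A in LHS]setIT -integral_indic// integral_uniform//.
- by rewrite subr0 invr1 mul1e integral_indic// setIidl.
- by apply/measurable_EFinP; exact: measurable_indic.
Qed.

Lemma uniform_cube_box k (A : 'I_k -> set (measurableTypeR R)) (l : R) :
  (forall i, measurable (A i)) -> (forall i, U (A i) = l%:E) ->
  uniform_cube R k [set x | forall i, A i (tnth x i)] = (l ^+ k)%:E.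
Proof.
move=> mA UA; rewrite /uniform_cube iid_cylinder//.
rewrite (eq_bigr (fun=> l%:E)) => [|i _]; last exact: UA.
by rewrite prodEFin prodr_const card_ord.
Qed.

Lemma dist2C k (x y : k.-tuple R) : dist2 x y = dist2 y x.
Proof. by rewrite /dist2; congr Num.sqrt; apply: eq_bigr => i _; rewrite -sqrrN opprB. Qed.

Section fixed_size.
Variables k n : nat.
Local Notation Tk := (k.-tuple (measurableTypeR R)).
Local Notation P := (locations R k n).

Definition close_pair (rho : R) (i j : 'I_n) (sd : n.-tuple Tk * n.-tuple Tk) : bool :=
  (dist2 (tnth sd.1 i) (tnth sd.2 j) <= rho)%R.

Lemma measurable_close_pair rho i j : measurable [set sd | close_pair rho i j sd].
Proof.
apply: (measurable_dist2_le (f := fun sd : n.-tuple Tk * n.-tuple Tk => tnth sd.1 i)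
  (g := fun sd => tnth sd.2 j)).
- exact: (measurableT_comp (measurable_tnth i) measurable_fst).
- exact: (measurableT_comp (measurable_tnth j) measurable_snd).
Qed.

Lemma measurable_close_pair2 rho rho' i j i' j' :
  measurable [set sd | close_pair rho i j sd && close_pair rho' i' j' sd].
Proof.
rewrite (_ : mkset _ =
    [set sd | close_pair rho i j sd] `&` [set sd | close_pair rho' i' j' sd]).
  by apply: measurableI; exact: measurable_close_pair.
by apply/seteqP; split=> w /= /andP.
Qed.

Lemma prob_close_pair_le (rho : R) i j : (0 <= rho)%R ->
  P [set sd | close_pair rho i j sd] <= (V k * rho ^+ k)%:E.
Proof.
move=> rho0; apply: product_xsection_le; first exact: measurable_close_pair.
move=> s; rewrite [X in iid _ _ X](_ : _ = [set d | dist2 (tnth s i) (tnth d j) <= rho]%R)//.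
rewrite (iid_marginal (uniform_cube R k) j (A := [set d | dist2 (tnth s i) d <= rho]%R)).
  exact: uniform_cube_ball2_le.
exact: measurable_ball2.
Qed.

(** Given the common end, the other two are independent, and each lies within reach
with probability at most the volume of the ball. *)
Lemma prob_fork_supply_le (rho : R) i j j' : (0 <= rho)%R -> j != j' ->
  P [set sd | close_pair rho i j sd && close_pair rho i j' sd]
    <= ((V k * rho ^+ k) * (V k * rho ^+ k))%:E.
Proof.
move=> rho0 jj'; apply: product_xsection_le; first exact: measurable_close_pair2.
move=> s; pose A : set Tk := [set d | dist2 (tnth s i) d <= rho]%R.
have mA : measurable A by exact: measurable_ball2.
rewrite [X in iid _ _ X](_ : _ = [set d | A (tnth d j) /\ A (tnth d j')]); last first.
  by apply/seteqP; split=> d /= /andP.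
rewrite iid_marginal2// EFinM.
by apply: lee_pmul => //; exact: uniform_cube_ball2_le.
Qed.

Lemma prob_fork_demand_le (rho rho' : R) i i' j : (0 <= rho)%R -> (0 <= rho')%R -> i != i' ->
  P [set sd | close_pair rho i j sd && close_pair rho' i' j sd]
    <= ((V k * rho ^+ k) * (V k * rho' ^+ k))%:E.
Proof.
move=> rho0 rho'0 ii'; apply: product_ysection_le; first exact: measurable_close_pair2.
move=> d; pose A rho : set Tk := [set s | dist2 (tnth d j) s <= rho]%R.
have mA r : measurable (A r) by exact: measurable_ball2.
rewrite [X in iid _ _ X](_ : _ = [set s | A rho (tnth s i) /\ A rho' (tnth s i')]); last first.
  by apply/seteqP; split=> s /=; rewrite /close_pair/= /A/= !(dist2C (tnth d j)) => /andP.
rewrite iid_marginal2// EFinM.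
by apply: lee_pmul => //; exact: uniform_cube_ball2_le.
Qed.

(** The last factor is the probability that the supply node is at distance at
least rho from every face of the cube, in which case its whole ball lies in the
cube. *)
Lemma prob_close_pair_ge (rho : R) i j : (0 <= rho)%R -> (rho <= 2^-1)%R ->
  (V k * rho ^+ k * (1 - 2 * rho) ^+ k)%:E <= P [set sd | close_pair rho i j sd].
Proof.
move=> rho0 rho1.
pose I : set (measurableTypeR R) := [set` `[rho, (1 - rho)%R]].
have mI : measurable I by exact: measurable_itv.
have UI : U I = (1 - 2 * rho)%:E.
  rewrite uniform_prob01E//; last first.
    by rewrite /I => x /=; rewrite !in_itv/=; lra.
  rewrite /I lebesgue_measure_itv/= lte_fin; case: ifPn => [_|].
    by rewrite -EFinB; congr EFin; lra.
  by rewrite -leNgt => ?; congr EFin; lra.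
pose C : set Tk := [set x | forall l, I (tnth x l)].
have mC : measurable C.
  have -> : C = \bigcap_(l in [set: 'I_k]) ((fun x : Tk => tnth x l) @^-1` I).
    by apply/seteqP; split=> x Cx l => [_|]; exact: Cx.
  apply: fin_bigcap_measurable => // l _.
  by rewrite -[X in measurable X]setTI; exact: (measurable_tnth l).
have mCi : measurable [set s : n.-tuple Tk | C (tnth s i)].
  by rewrite -[X in measurable X]setTI; exact: (measurable_tnth i).
rewrite EFinM; have <- : iid (uniform_cube R k) n [set s | C (tnth s i)] = ((1 - 2 * rho) ^+ k)%:E.
  by rewrite iid_marginal//; exact: (uniform_cube_box (fun=> mI) (fun=> UI)).
apply: product_xsection_ge => //.
- by rewrite mulr_ge0 ?exprn_ge0// ltW// ball_volume_gt0.
- exact: measurable_close_pair.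
- move=> s Cs.
  rewrite (iid_marginal (uniform_cube R k) j (A := [set d | dist2 (tnth s i) d <= rho]%R)).
    by apply: uniform_cube_ball2_ge => // l; exact: Cs.
  exact: measurable_ball2.
Qed.

End fixed_size.
End edge_probabilities.

(** * First-order bounds on the expected matching size *)

Lemma powR_Ninv_exprn (R : realType) (k n : nat) : (0 < k)%N ->
  (n%:R `^ (- k%:R^-1)) ^+ k = n%:R^-1 :> R.
Proof.
move=> k0; rewrite -powR_mulrn ?powR_ge0// -powRrM mulNr mulVf ?pnatr_eq0 -?lt0n//.
by rewrite powR_inv1// ler0n.
Qed.

Section first_order.
Local Open Scope ereal_scope.
Variable R : realType.
Local Notation V := (ball_volume R).
Variables k n : nat.
Local Notation Tk := (k.-tuple (measurableTypeR R)).
Local Notation P := (locations R k n).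
Implicit Types (r : 'rV[R]_n) (sd : n.-tuple Tk * n.-tuple Tk).

Definition scaled_radius r (i : 'I_n) : R := (r ord0 i * n%:R `^ (- k%:R^-1))%R.

Lemma in_geom_graph r i j sd :
  ((i, j) \in geom_graph r sd.1 sd.2) = close_pair (scaled_radius r i) i j sd.
Proof. by rewrite inE. Qed.

(** Every function of the random graph is a finite combination of indicators of
events on pairwise distances. *)
Lemma measurable_geom_graph r (F : {set 'I_n * 'I_n} -> R) :
  measurable_fun setT (fun sd => F (geom_graph r sd.1 sd.2)).
Proof.
have -> : (fun sd => F (geom_graph r sd.1 sd.2)) =
    (fun sd => (\sum_H F H * (geom_graph r sd.1 sd.2 == H)%:R)%R).
  apply/funext => sd; rewrite (bigD1 (geom_graph r sd.1 sd.2))//= eqxx mulr1.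
  by rewrite big1 ?addr0// => H /negbTE; rewrite eq_sym => ->; rewrite mulr0.
apply: measurable_sum => H; apply: measurable_funM; first exact: measurable_cst.
apply: measurable_natr_bool.
pose E e : set (n.-tuple Tk * n.-tuple Tk) :=
  [set sd | close_pair (scaled_radius r e.1) e.1 e.2 sd].
rewrite (_ : mkset _ = \bigcap_(e in [set: 'I_n * 'I_n])
    (if e \in H then E e else ~` E e)).
  apply: fin_bigcap_measurable => // e _.
  by case: ifP => _; [|apply: measurableC]; exact: measurable_close_pair.
apply/seteqP; split=> sd /=.
  by move=> /eqP <- [i j] _; rewrite in_geom_graph /E; case: ifPn => //= /negP.
move=> h; apply/eqP/setP => -[i j]; rewrite in_geom_graph.
by have := h (i, j) I; rewrite /E; case: ifPn => //= _ /negP/negbTE.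
Qed.

Lemma expectation_edge r i j :
  'E_P[fun sd => ((i, j) \in geom_graph r sd.1 sd.2)%:R] =
  P [set sd | close_pair (scaled_radius r i) i j sd].
Proof.
under [X in 'E_P[X]]eq_fun do rewrite in_geom_graph.
by rewrite expectation_bool//; exact: measurable_close_pair.
Qed.

Lemma expectation_edge2 r i j i' j' :
  'E_P[fun sd => (((i, j) \in geom_graph r sd.1 sd.2) &&
                  ((i', j') \in geom_graph r sd.1 sd.2))%:R] =
  P [set sd | close_pair (scaled_radius r i) i j sd && close_pair (scaled_radius r i') i' j' sd].
Proof.
under [X in 'E_P[X]]eq_fun do rewrite !in_geom_graph.
by rewrite expectation_bool//; exact: measurable_close_pair2.
Qed.

Hypotheses (k0 : (0 < k)%N) (n0 : (0 < n)%N).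

Lemma scaled_radius_ge0 r i : (0 <= r ord0 i)%R -> (0 <= scaled_radius r i)%R.
Proof. by move=> r0; rewrite mulr_ge0// powR_ge0. Qed.

Lemma scaled_radiusXk r i : (scaled_radius r i ^+ k = r ord0 i ^+ k / n%:R)%R.
Proof. by rewrite /scaled_radius exprMn powR_Ninv_exprn. Qed.

(** The expected number of edges starting at i is at most V_k r_i^k.  The case of an
empty A bounds the matching size by the number of edges; the case where r vanishes
outside A bounds it by the number of nodes with a nonzero radius. *)
Lemma mu_le_cover r (A : {set 'I_n}) : (forall i, 0 <= r ord0 i)%R ->
  mu k r <= (#|A|%:R + V k * \sum_(i | i \notin A) r ord0 i ^+ k)%:E.
Proof.
move=> r0.
pose f (H : {set 'I_n * 'I_n}) : R := (\sum_(e | e.1 \notin A) (e \in H)%:R)%R.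
have mf : measurable_fun setT (fun sd => f (geom_graph r sd.1 sd.2)).
  exact: measurable_geom_graph.
apply: (@le_trans _ _ 'E_P[fun sd => (cst #|A|%:R sd + f (geom_graph r sd.1 sd.2))%R]).
  apply: expectation_ge0_le => //.
  - exact: (measurable_geom_graph r (fun H => (max_matching H)%:R)).
  - by apply: measurable_funD => //; exact: measurable_cst.
  - move=> sd; rewrite /f -natr_sum -natrD ler_nat.
    exact: max_matching_le_cover.
rewrite expectation_ge0D//; last first.
  by move=> sd; apply: sumr_ge0.
rewrite expectation_cst EFinD leeD2l// expectation_ge0_sum//; last first.
  by move=> e; exact: (measurable_geom_graph r (fun H => (e \in H)%:R)).
apply: (@le_trans _ _ (\sum_(e : 'I_n * 'I_n | e.1 \notin A) (V k * (r ord0 e.1 ^+ k / n%:R))%:E)).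
  apply: lee_sum => -[i j] _; rewrite expectation_edge -scaled_radiusXk.
  by apply: prob_close_pair_le; exact: scaled_radius_ge0.
rewrite sumEFin lee_fin mulr_sumr.
rewrite (eq_bigl (fun e : 'I_n * 'I_n => (e.1 \notin A) && true)); last first.
  by move=> e; rewrite andbT.
rewrite -(pair_big (fun i => i \notin A) xpredT
  (fun i j => (V k * (r ord0 i ^+ k / n%:R))%R))/=.
have nn0 : n%:R != 0%R :> R by rewrite pnatr_eq0 -lt0n.
apply: ler_sum => i _; rewrite sumr_const card_ord -[leLHS]mulr_natr.
by rewrite le_eqVlt; apply/orP; left; apply/eqP; field.
Qed.

(** The subtracted term bounds the expected number of pairs of edges with a common
end: there are at most 2 n^3 such pairs of potential edges, and each is present with
probability at most (V_k B / n)^2. *)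
Lemma mu_ge_first_order r (B delta : R) : (forall i, 0 <= r ord0 i)%R ->
  (forall i, r ord0 i ^+ k <= B)%R -> (forall i, scaled_radius r i <= delta)%R ->
  (0 <= delta)%R -> (delta <= 2^-1)%R ->
  (V k * (1 - 2 * delta) ^+ k * (\sum_(i < n) r ord0 i ^+ k)
     - 2 * (V k * B) ^+ 2 * n%:R)%:E <= mu k r.
Proof.
move=> r0 rB rdelta delta0 delta1.
have nn0 : n%:R != 0%R :> R by rewrite pnatr_eq0 -lt0n.
have V0 : (0 <= V k)%R by exact/ltW/ball_volume_gt0.
have rad0 i : (0 <= scaled_radius r i)%R by exact: scaled_radius_ge0.
pose f (H : {set 'I_n * 'I_n}) : R := (\sum_i \sum_j ((i, j) \in H)%:R)%R.
pose g (H : {set 'I_n * 'I_n}) : R :=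
  (\sum_i \sum_j \sum_(j' | j' != j) (((i, j) \in H) && ((i, j') \in H))%:R)%R.
pose h (H : {set 'I_n * 'I_n}) : R :=
  (\sum_j \sum_i \sum_(i' | i' != i) (((i, j) \in H) && ((i', j) \in H))%:R)%R.
pose M (H : {set 'I_n * 'I_n}) : R := (max_matching H)%:R.
pose G sd := geom_graph r sd.1 sd.2.
have mG F : measurable_fun setT (fun sd => F (G sd) : R).
  exact: measurable_geom_graph.
have f_le H : (f H <= M H + g H + h H)%R.
  have -> : f H = #|H|%:R.
    rewrite /f pair_big/= -sum1_card natr_sum [RHS]big_mkcond/=.
    by apply: eq_bigr => -[i j] _ /=; case: (_ \in H).
  have natr3 (F : 'I_n -> 'I_n -> 'I_n -> bool) :
      ((\sum_i \sum_j \sum_(l | l != j) F i j l)%N%:R =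
        \sum_i \sum_j \sum_(l | l != j) (F i j l)%:R :> R)%R.
    rewrite natr_sum; apply: eq_bigr => i _; rewrite natr_sum; apply: eq_bigr => j _.
    exact: natr_sum.
  by have := card_le_max_matching H; rewrite -(ler_nat R) !natrD !natr3.
have g0 H : (0 <= g H)%R by do 3 (apply: sumr_ge0 => ? _).
have h0 H : (0 <= h H)%R by do 3 (apply: sumr_ge0 => ? _).
have M0 H : (0 <= M H)%R by exact: ler0n.
have Ele : 'E_P[fun sd => f (G sd)] <=
    'E_P[fun sd => M (G sd)] + 'E_P[fun sd => g (G sd)] + 'E_P[fun sd => h (G sd)].
  rewrite -expectation_ge0D// -expectation_ge0D//.
  - apply: expectation_ge0_le => //.
    + exact: (mG (fun H => M H + g H + h H)%R).
    + by move=> sd; do 2 (apply: sumr_ge0 => ? _).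
  - exact: (mG (fun H => M H + g H)%R).
  - by move=> sd; rewrite addr_ge0.
have pairB i i' :
    (V k * scaled_radius r i ^+ k * (V k * scaled_radius r i' ^+ k)
     <= (V k * B) ^+ 2 / n%:R ^+ 2)%R.
  rewrite !scaled_radiusXk -expr_div_n expr2.
  have le1 l : (V k * (r ord0 l ^+ k / n%:R) <= V k * B / n%:R)%R.
    by rewrite mulrA ler_wpM2r ?invr_ge0// ler_wpM2l.
  by apply: ler_pM => //; rewrite mulr_ge0// divr_ge0// exprn_ge0.
pose c : R := ((V k * B) ^+ 2 / n%:R ^+ 2)%R.
have c0 : (0 <= c)%R by rewrite divr_ge0// sqr_ge0.
have sum_c (Q : 'I_n -> pred 'I_n) :
    \sum_(i < n) \sum_(j < n) \sum_(l < n | Q j l) c%:E <= ((V k * B) ^+ 2 * n%:R)%:E.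
  apply: (@le_trans _ _ (\sum_(i < n) \sum_(j < n) \sum_(l < n) c%:E)).
    apply: lee_sum => i _; apply: lee_sum => j _.
    by rewrite !sumEFin lee_fin [leRHS](bigID (Q j))/= lerDl sumr_ge0.
  rewrite (eq_bigr (fun=> (c * n%:R * n%:R)%:E)) => [|i _]; last first.
    rewrite (eq_bigr (fun=> (c * n%:R)%:E)) => [|j _].
      by rewrite sumEFin sumr_const card_ord [in RHS]mulr_natr.
    by rewrite sumEFin sumr_const card_ord mulr_natr.
  rewrite sumEFin sumr_const card_ord lee_fin -[leLHS]mulr_natr /c.
  by rewrite le_eqVlt; apply/orP; left; apply/eqP; field.
have EsumG (Q : pred 'I_n) (F : 'I_n -> {set 'I_n * 'I_n} -> R) :
    (forall i H, 0 <= F i H)%R ->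
    'E_P[fun sd => (\sum_(i | Q i) F i (G sd))%R] =
    \sum_(i | Q i) 'E_P[fun sd => F i (G sd)].
  by move=> F0; rewrite expectation_ge0_sum// => i; exact: mG.
have EsumG3 (F : 'I_n -> 'I_n -> 'I_n -> {set 'I_n * 'I_n} -> R) :
    (forall i j l H, 0 <= F i j l H)%R ->
    'E_P[fun sd => (\sum_i \sum_j \sum_(l | l != j) F i j l (G sd))%R] =
    \sum_i \sum_j \sum_(l | l != j) 'E_P[fun sd => F i j l (G sd)].
  move=> F0.
  rewrite (EsumG xpredT (fun i H => \sum_j \sum_(l | l != j) F i j l H)%R); last first.
    by move=> i H; do 2 (apply: sumr_ge0 => ? _).
  apply: eq_bigr => i _.
  rewrite (EsumG xpredT (fun j H => \sum_(l | l != j) F i j l H)%R); last first.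
    by move=> j H; apply: sumr_ge0.
  by apply: eq_bigr => j _; rewrite EsumG.
have Eg : 'E_P[fun sd => g (G sd)] <= ((V k * B) ^+ 2 * n%:R)%:E.
  apply: le_trans (sum_c (fun j j' => j' != j)).
  rewrite (EsumG3 (fun i j j' H => (((i, j) \in H) && ((i, j') \in H))%:R))//.
  apply: lee_sum => i _; apply: lee_sum => j _; apply: lee_sum => j' j'j.
  rewrite expectation_edge2; apply: le_trans (prob_fork_supply_le _ _ _ _) _ => //.
    by rewrite eq_sym.
  by rewrite lee_fin.
have Eh : 'E_P[fun sd => h (G sd)] <= ((V k * B) ^+ 2 * n%:R)%:E.
  apply: le_trans (sum_c (fun j j' => j' != j)).
  rewrite (EsumG3 (fun j i i' H => (((i, j) \in H) && ((i', j) \in H))%:R))//.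
  apply: lee_sum => j _; apply: lee_sum => i _; apply: lee_sum => i' i'i.
  rewrite expectation_edge2; apply: le_trans (prob_fork_demand_le _ _ _ _ _) _ => //.
    by rewrite eq_sym.
  by rewrite lee_fin.
have Ef : (V k * (1 - 2 * delta) ^+ k * (\sum_(i < n) r ord0 i ^+ k))%:E
    <= 'E_P[fun sd => f (G sd)].
  rewrite (EsumG xpredT (fun i H => \sum_j ((i, j) \in H)%:R)%R); last first.
    by move=> i H; apply: sumr_ge0.
  rewrite mulr_sumr -sumEFin; apply: lee_sum => i _.
  rewrite (EsumG xpredT (fun j H => ((i, j) \in H)%:R))//.
  apply: (@le_trans _ _ (\sum_(j < n) (V k * scaled_radius r i ^+ k * (1 - 2 * delta) ^+ k)%:E)).
    rewrite sumEFin sumr_const card_ord lee_fin scaled_radiusXk -[leRHS]mulr_natr.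
    by rewrite le_eqVlt; apply/orP; left; apply/eqP; field.
  apply: lee_sum => j _; rewrite expectation_edge.
  apply: le_trans (prob_close_pair_ge _ _ _ _ _) => //; last exact: le_trans (rdelta i) _.
  rewrite lee_fin ler_wpM2l ?mulr_ge0 ?exprn_ge0// lerXn2r ?nnegrE//.
  - by lra.
  - by have := rdelta i; lra.
  - by rewrite lerD2l lerN2 ler_wpM2l.
have := le_trans Ef (le_trans Ele (leeD (leeD (lexx _) Eg) Eh)).
rewrite -addeA -EFinD -leeBlDr// -EFinB => H.
apply: le_trans H; rewrite lee_fin.
by rewrite mulrDl mul1r; lra.
Qed.

End first_order.

(** * Matching inside the cells of a grid *)

Section cells.
Local Open Scope ereal_scope.
Variable R : realType.
Local Notation U := (uniform_prob (@ltr01 R)).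
Variables k l : nat.
Hypothesis l0 : (0 < l)%N.
Local Notation Tk := (k.-tuple (measurableTypeR R)).

Definition in_cell (c : {ffun 'I_k -> 'I_l}) (x : k.-tuple R) : bool :=
  [forall i, (c i)%:R / l%:R <= tnth x i < (c i).+1%:R / l%:R]%R.

Let lR0 : (0 < l%:R :> R)%R. Proof. by rewrite ltr0n. Qed.

Lemma in_cell_inj c c' x : in_cell c x -> in_cell c' x -> c = c'.
Proof.
move=> /forallP h /forallP h'; apply/ffunP => i; apply/val_inj/eqP => /=.
have := h i; have := h' i.
rewrite !ler_pdivrMr// !ltr_pdivlMr// => /andP[a1 a2] /andP[b1 b2].
have := le_lt_trans a1 b2; have := le_lt_trans b1 a2.
by rewrite !ltr_nat; lia.
Qed.

Lemma dist2_in_cell c (x y : k.-tuple R) (rho : R) : (0 <= rho)%R ->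
  (k%:R <= (l%:R * rho) ^+ 2)%R -> in_cell c x -> in_cell c y -> (dist2 x y <= rho)%R.
Proof.
move=> rho0 kl /forallP h /forallP h'; rewrite dist2_le//.
apply: (@le_trans _ _ (\sum_(i < k) (l%:R^-1) ^+ 2)%R).
  apply: ler_sum => i _; have := h i; have := h' i.
  rewrite -![((c i).+1%:R)%R]natr1 !mulrDl mul1r => /andP[a1 a2] /andP[b1 b2].
  rewrite -[leLHS]real_normK ?num_real//.
  by rewrite lerXn2r ?nnegrE ?invr_ge0 ?ler0n// ler_norml; lra.
rewrite sumr_const card_ord -[leLHS]mulr_natl exprVn ler_pdivrMr ?exprn_gt0//.
by rewrite mulrC -exprMn.
Qed.

Lemma measurable_in_cell c : measurable [set x : Tk | in_cell c x].
Proof.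
rewrite (_ : mkset _ = \bigcap_(i in [set: 'I_k])
    ((fun x : Tk => tnth x i) @^-1` [set` `[((c i)%:R / l%:R)%R, ((c i).+1%:R / l%:R)%R[])).
  apply: fin_bigcap_measurable => // i _.
  rewrite -[X in measurable X]setTI; apply: measurable_tnth => //.
apply/seteqP; split=> x /=.
  by move=> /forallP h i _; have := h i; rewrite /= in_itv.
by move=> h; apply/forallP => i; have := h i I; rewrite /= in_itv.
Qed.

Lemma prob_in_cell c : uniform_cube R k [set x | in_cell c x] = (l%:R^-1 ^+ k)%:E.
Proof.
pose I i : set (measurableTypeR R) :=
  [set` `[((c i)%:R / l%:R)%R, ((c i).+1%:R / l%:R)%R[].
rewrite -(@uniform_cube_box R k I).
- congr (uniform_cube _ _ _); apply/seteqP; split=> x /=.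
    by move=> /forallP h i; have := h i; rewrite /I/= in_itv.
  by move=> h; apply/forallP => i; have := h i; rewrite /I/= in_itv.
- by move=> i; exact: measurable_itv.
- move=> i; rewrite uniform_prob01E.
  + rewrite lebesgue_measure_itv/= lte_fin ltr_pM2r ?invr_gt0// ltr_nat ltnSn.
    by rewrite -EFinB; congr EFin; rewrite -mulrBl -natrB// subSnn mul1r.
  + exact: measurable_itv.
  + move=> x; rewrite /I/= !in_itv/= => /andP[h1 h2].
    rewrite (le_trans _ h1) ?divr_ge0//= (le_trans (ltW h2))//.
    by rewrite ler_pdivrMr// mul1r ler_nat.
Qed.

Section fixed_size.
Variable n : nat.
Local Notation P := (locations R k n).

Lemma prob_supply (B : set (n.-tuple Tk)) : measurable B ->
  P [set sd | B sd.1] = iid (uniform_cube R k) n B.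
Proof.
move=> mB; rewrite (_ : mkset _ = B `*` setT); last first.
  by apply/seteqP; split=> -[s d] //= [].
rewrite -[RHS]mule1 -(probability_setT (iid (uniform_cube R k) n)).
exact: product_measure1E.
Qed.

Lemma prob_demand (B : set (n.-tuple Tk)) : measurable B ->
  P [set sd | B sd.2] = iid (uniform_cube R k) n B.
Proof.
move=> mB; rewrite (_ : mkset _ = setT `*` B); last first.
  by apply/seteqP; split=> -[s d] //= [].
rewrite -[RHS]mul1e -(probability_setT (iid (uniform_cube R k) n)).
exact: product_measure1E.
Qed.

Let measurable_tuple_in_cell c i : measurable [set s : n.-tuple Tk | in_cell c (tnth s i)].
Proof.
rewrite -[X in measurable X]setTI.
exact: (measurable_tnth i measurableT (measurable_in_cell c)).
Qed.

Let measurable_tuple_in_cell2 c i j :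
  measurable [set s : n.-tuple Tk | in_cell c (tnth s i) && in_cell c (tnth s j)].
Proof.
rewrite (_ : mkset _ = [set s : n.-tuple Tk | in_cell c (tnth s i)] `&`
   [set s : n.-tuple Tk | in_cell c (tnth s j)]).
  by apply: measurableI; exact: measurable_tuple_in_cell.
by apply/seteqP; split=> w /= /andP.
Qed.

Let prob_tuple_in_cell c i :
  iid (uniform_cube R k) n [set s | in_cell c (tnth s i)] = (l%:R^-1 ^+ k)%:E.
Proof.
rewrite -(prob_in_cell c).
exact: (iid_marginal _ i (measurable_in_cell c)).
Qed.

Let prob_tuple_in_cell2 c i j : i != j ->
  iid (uniform_cube R k) n [set s | in_cell c (tnth s i) && in_cell c (tnth s j)]
  = ((l%:R^-1 ^+ k) ^+ 2)%:E.
Proof.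
move=> ij; rewrite expr2 EFinM -!(prob_in_cell c).
rewrite -(iid_marginal2 _ ij (measurable_in_cell c) (measurable_in_cell c)).
by congr (iid _ _ _); apply/seteqP; split=> w /= /andP.
Qed.

Let measurable_supply (B : set (n.-tuple Tk)) : measurable B ->
  measurable [set sd : n.-tuple Tk * n.-tuple Tk | B sd.1].
Proof. by move=> mB; rewrite -[X in measurable X]setTI; exact: measurable_fst. Qed.

Let measurable_demand (B : set (n.-tuple Tk)) : measurable B ->
  measurable [set sd : n.-tuple Tk * n.-tuple Tk | B sd.2].
Proof. by move=> mB; rewrite -[X in measurable X]setTI; exact: measurable_snd. Qed.

Lemma supply_count_sqr_le c (A : {set 'I_n}) :
  'E_P[fun sd => ((\sum_(i in A) (in_cell c (tnth sd.1 i))%:R - #|A|%:R * l%:R^-1 ^+ k) ^+ 2)%R]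
  <= (#|A|%:R * l%:R^-1 ^+ k)%:E.
Proof.
apply: (@expectation_count_sqr_le _ _ R P _ A (fun i sd => in_cell c (tnth sd.1 i))).
- by move=> i; exact: (measurable_supply (measurable_tuple_in_cell c i)).
- by move=> i; rewrite -(prob_tuple_in_cell c i); exact: prob_supply.
- move=> i j ij; rewrite -(prob_tuple_in_cell2 c ij); exact: prob_supply.
Qed.

Lemma demand_count_sqr_le c (A : {set 'I_n}) :
  'E_P[fun sd => ((\sum_(i in A) (in_cell c (tnth sd.2 i))%:R - #|A|%:R * l%:R^-1 ^+ k) ^+ 2)%R]
  <= (#|A|%:R * l%:R^-1 ^+ k)%:E.
Proof.
apply: (@expectation_count_sqr_le _ _ R P _ A (fun i sd => in_cell c (tnth sd.2 i))).
- by move=> i; exact: (measurable_demand (measurable_tuple_in_cell c i)).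
- by move=> i; rewrite -(prob_tuple_in_cell c i); exact: prob_demand.
- move=> i j ij; rewrite -(prob_tuple_in_cell2 c ij); exact: prob_demand.
Qed.

(** A quadratic lower bound on the minimum of two counts in terms of the mean of the
smaller one; it comes from u >= - e / 2 - u^2 / (2 e), that is (u + e)^2 >= 0. *)
Lemma minr_ge_sqr_dev (x y a b e : R) : (0 < e)%R -> (a <= b)%R ->
  (a - e - e^-1 / 2 * ((x - a) ^+ 2 + (y - b) ^+ 2) <= Num.min x y)%R.
Proof.
move=> e0 ab.
have dev u : (- e / 2 - e^-1 / 2 * u ^+ 2 <= u)%R.
  rewrite -subr_ge0 [leRHS](_ : _ = e^-1 / 2 * (u + e) ^+ 2)%R.
    by rewrite mulr_ge0 ?sqr_ge0// divr_ge0// invr_ge0 ltW.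
  by field; exact: lt0r_neq0.
have c0 z : (0 <= e^-1 / 2 * z ^+ 2)%R.
  by rewrite mulr_ge0 ?sqr_ge0// divr_ge0// invr_ge0 ltW.
have := dev (x - a)%R; have := dev (y - b)%R.
have := c0 (x - a)%R; have := c0 (y - b)%R.
by rewrite mulrDr le_min => ? ? ? ?; apply/andP; split; lra.
Qed.

(** There are l^k cells.  In each of them the two counts deviate from their means
with variances at most n / l^k, so that the loss below the mean number of nodes of
large radius is at most e + n / (l^k e). *)
Lemma mu_ge_cells (r : 'rV[R]_n) (rho e : R) : (0 <= rho)%R ->
  (k%:R <= (l%:R * rho) ^+ 2)%R -> (0 < e)%R ->
  (#|[set i | (rho <= scaled_radius k r i)%R]%SET|%:R - (l ^ k)%:R * e - n%:R / e)%:E <= mu k r.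
Proof.
move=> rho0 kl e0; set A := [set i | _]%SET; set N : R := #|A|%:R.
pose G (sd : n.-tuple Tk * n.-tuple Tk) := geom_graph r sd.1 sd.2.
(* The lower bound must be nonnegative for the integrals to be compared. *)
have [neg|pos] := leP (N - (l ^ k)%:R * e)%R 0%R.
  apply: (@le_trans _ _ 0%E); last by rewrite /mu; apply: expectation_ge0 => sd; exact: ler0n.
  rewrite lee_fin subr_le0 (le_trans neg)// divr_ge0//; exact: ltW.
set p : R := (l%:R^-1 ^+ k)%R.
have mp : ((l ^ k)%:R * p = 1)%R.
  by rewrite /p natrX -exprMn divff ?expr1n//; exact: lt0r_neq0.
have p0 : (0 <= p)%R by rewrite exprn_ge0// invr_ge0 ler0n.
pose S c (sd : n.-tuple Tk * n.-tuple Tk) : R :=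
  (\sum_(i in A) (in_cell c (tnth sd.1 i))%:R)%R.
pose D c (sd : n.-tuple Tk * n.-tuple Tk) : R :=
  (\sum_(i in [set: 'I_n]%SET) (in_cell c (tnth sd.2 i))%:R)%R.
have mS c : measurable_fun setT (S c).
  apply: measurable_sum_cond => i; apply: measurable_natr_bool.
  exact: (measurable_supply (measurable_tuple_in_cell c i)).
have mD c : measurable_fun setT (D c).
  apply: measurable_sum_cond => i; apply: measurable_natr_bool.
  exact: (measurable_demand (measurable_tuple_in_cell c i)).
pose q c sd : R := ((S c sd - N * p) ^+ 2)%R.
pose q' c sd : R := ((D c sd - #|[set: 'I_n]%SET|%:R * p) ^+ 2)%R.
have cT : #|[set: 'I_n]%SET| = n by rewrite cardsT card_ord.
have Nn : (N <= n%:R)%R by rewrite ler_nat -[leqRHS]card_ord max_card.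
have mq c : measurable_fun setT (q c).
  by apply: measurable_funX; apply: measurable_funB => //; exact: measurable_cst.
have mq' c : measurable_fun setT (q' c).
  by apply: measurable_funX; apply: measurable_funB => //; exact: measurable_cst.
pose Q sd : R := (\sum_c (q c sd + q' c sd))%R.
have mQ : measurable_fun setT Q.
  by apply: measurable_sum => c; exact: measurable_funD.
have q0 c sd : (0 <= q c sd)%R by exact: sqr_ge0.
have q'0 c sd : (0 <= q' c sd)%R by exact: sqr_ge0.
have Q0 sd : (0 <= Q sd)%R by apply: sumr_ge0 => c _; rewrite addr_ge0.
have ceK : (0 <= e^-1 / 2)%R by rewrite divr_ge0// invr_ge0 ltW.
have mM : measurable_fun setT (fun sd => (max_matching (G sd))%:R : R).
  exact: (measurable_geom_graph (k := k) r (fun H => (max_matching H)%:R)).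
have cardC : #|{: {ffun 'I_k -> 'I_l}}| = (l ^ k)%N by rewrite card_ffun !card_ord.
have key sd : (N - (l ^ k)%:R * e <= (max_matching (G sd))%:R + e^-1 / 2 * Q sd)%R.
  pose Ac c := [set i in A | in_cell c (tnth sd.1 i)]%SET.
  pose Bc c := [set j | in_cell c (tnth sd.2 j)]%SET.
  have cardAc c : #|Ac c|%:R = S c sd.
    rewrite /S -sum1_card natr_sum big_mkcond [RHS]big_mkcond; apply: eq_bigr => i _.
    by rewrite inE; case: (i \in A); case: (in_cell _ _).
  have cardBc c : #|Bc c|%:R = D c sd.
    rewrite /D -sum1_card natr_sum big_mkcond [RHS]big_mkcond; apply: eq_bigr => i _.
    by rewrite !inE; case: (in_cell _ _).
  have : (\sum_c minn #|Ac c| #|Bc c| <= max_matching (G sd))%N.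
    apply: max_matching_cells.
    - by move=> c c' i; rewrite !inE => /andP[_ h] /andP[_ h']; exact: in_cell_inj h h'.
    - by move=> c c' i; rewrite !inE; exact: in_cell_inj.
    - move=> c i j; rewrite !inE => /andP[iA ic] jc /=.
      exact: le_trans (dist2_in_cell rho0 kl ic jc) iA.
  rewrite -(ler_nat R) natr_sum => Mge.
  rewrite -lerBlDr; apply: le_trans Mge.
  rewrite /Q mulr_sumr.
  have -> : (N - (l ^ k)%:R * e = \sum_(c : {ffun 'I_k -> 'I_l}) (N * p - e))%R.
    by rewrite sumr_const cardC -[RHS]mulr_natl mulrBr mulrCA mp mulr1.
  rewrite -sumrB; apply: ler_sum => c _.
  rewrite natr_min cardAc cardBc; apply: minr_ge_sqr_dev => //.
  by rewrite cT ler_wpM2r.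
have mcQ : measurable_fun setT (fun sd => e^-1 / 2 * Q sd)%R.
  by apply: measurable_funM => //; exact: measurable_cst.
have : (N - (l ^ k)%:R * e)%:E <=
    'E_P[fun sd => (max_matching (G sd))%:R] + (e^-1 / 2)%:E * 'E_P[Q].
  rewrite -expectation_ge0Zl// -expectation_ge0D//.
  - rewrite -(expectation_cst P); apply: expectation_ge0_le => //.
    + exact: measurable_funD.
    + by move=> sd; exact: ltW.
  - by move=> sd; rewrite mulr_ge0.
have EQ : 'E_P[Q] <= (2 * n%:R)%:E.
  rewrite expectation_ge0_sum; [|by move=> c; exact: measurable_funD|
    by move=> c sd; rewrite addr_ge0].
  apply: (@le_trans _ _ (\sum_(c : {ffun 'I_k -> 'I_l}) (2 * n%:R * p)%:E)).
    apply: lee_sum => c _; rewrite expectation_ge0D//.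
    apply: (le_trans (leeD (supply_count_sqr_le c A) (demand_count_sqr_le c [set: 'I_n]%SET))).
    rewrite -EFinD lee_fin cT -/N -/p.
    have : (N * p <= n%:R * p)%R by rewrite ler_wpM2r.
    by lra.
  by rewrite sumEFin sumr_const cardC lee_fin -[leLHS]mulr_natl mulrCA mp mulr1.
move=> H; have {}H := le_trans H (leeD2l _ (lee_wpmul2l _ EQ)).
rewrite EFinB leeBlDr//; apply: le_trans (H _) _; first by rewrite lee_fin.
rewrite leeD2l// -EFinM lee_fin.
by rewrite le_eqVlt; apply/orP; left; apply/eqP; field; exact: lt0r_neq0.
Qed.

End fixed_size.
End cells.

(** * Comparison of the two radius vectors *)

Section comparisons.
Variable R : realType.
Local Notation V := (ball_volume R).

Lemma scale_le (k : nat) (c : R) : (0 < k)%N -> 0 < c ->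
  \forall n \near \oo, n%:R `^ (- k%:R^-1) <= c.
Proof.
move=> k0 c0; near=> n.
have n0 : (0 < n)%N by near: n; exact: nbhs_infty_gt.
have nR0 : 0 < n%:R :> R by rewrite ltr0n.
rewrite -(@ler_pXn2r _ k) ?nnegrE ?powR_ge0 ?(ltW c0)//.
rewrite powR_Ninv_exprn// invf_ple ?posrE ?exprn_gt0//.
by near: n; exact: nbhs_infty_ger.
Unshelve. all: by end_near. Qed.

(** Both error terms, the boundary effect of relative size 2 k delta and the incident
edges, are at most a quarter of the gap g between the power sums. *)
Lemma mu_lt_small (k n : nat) (r q : 'rV[R]_n) (L g t delta : R) :
  (0 < k)%N -> (0 < n)%N ->
  (forall i, 0 <= r ord0 i <= L) -> (forall i, 0 <= q ord0 i) ->
  \sum_(i < n) q ord0 i ^+ k + g * n%:R <= \sum_(i < n) r ord0 i ^+ k ->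
  0 < g -> 0 < t -> 0 <= delta <= 2^-1 -> t * L * n%:R `^ (- k%:R^-1) <= delta ->
  2 * k%:R * delta * L ^+ k <= g / 4 -> 2 * V k * L ^+ k ^+ 2 * t ^+ k <= g / 4 ->
  (mu k (t *: q) < mu k (t *: r))%E.
Proof.
move=> k0 n0 hr hq gap g0 t0 /andP[delta0 delta1] tL hd ht.
have V0 := ball_volume_gt0 R k.
have nR0 : 0 < n%:R :> R by rewrite ltr0n.
have tk0 : 0 < t ^+ k by rewrite exprn_gt0.
have rq0 (z : 'rV[R]_n) : (forall i, 0 <= z ord0 i) -> forall i, 0 <= (t *: z) ord0 i.
  by move=> z0 i; rewrite mxE mulr_ge0// ltW.
have sumE (z : 'rV[R]_n) :
    \sum_(i < n) (t *: z) ord0 i ^+ k = t ^+ k * \sum_(i < n) z ord0 i ^+ k.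
  by rewrite mulr_sumr; apply: eq_bigr => i _; rewrite mxE exprMn.
have r0 i : 0 <= r ord0 i by case/andP: (hr i).
have rL i : r ord0 i <= L by case/andP: (hr i).
have L0 : 0 <= L by exact: le_trans (r0 (Ordinal n0)) (rL _).
have up : (mu k (t *: q) <= (V k * (t ^+ k * \sum_(i < n) q ord0 i ^+ k))%:E)%E.
  apply: le_trans (mu_le_cover k0 n0 finset.set0 (rq0 _ hq)) _.
  rewrite cards0 add0r lee_fin -sumE ler_wpM2l ?(ltW V0)//.
  by rewrite le_eqVlt (eq_bigl xpredT) ?eqxx// => i; rewrite inE.
apply: (le_lt_trans up).
have low := @mu_ge_first_order R k n k0 n0 (t *: r) ((t * L) ^+ k) delta
  (rq0 _ r0) _ _ delta0 delta1.
apply: lt_le_trans (low _ _); last 2 first.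
- move=> i; rewrite mxE lerXn2r ?nnegrE ?mulr_ge0 ?(ltW t0)//.
  by rewrite ler_wpM2l// ltW.
- move=> i; apply: le_trans tL; rewrite /scaled_radius mxE.
  by rewrite ler_wpM2r ?powR_ge0// ler_wpM2l// ltW.
rewrite lte_fin sumE [(t * L) ^+ k]exprMn.
set Sr := \sum_(i < n) r ord0 i ^+ k in gap *; set Sq := \sum_(i < n) q ord0 i ^+ k in gap *.
have SrL : Sr <= n%:R * L ^+ k.
  apply: (@le_trans _ _ (\sum_(i < n) L ^+ k)).
    by apply: ler_sum => i _; rewrite lerXn2r ?nnegrE.
  by rewrite sumr_const card_ord -[leLHS]mulr_natl.
have Sr0 : 0 <= Sr by apply: sumr_ge0 => i _; exact: exprn_ge0.
have bern : 1 - 2 * k%:R * delta <= (1 - 2 * delta) ^+ k.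
  have d1 : 0 <= 1 - 2 * delta by lra.
  case: k k0 {hd ht gap tL V0 tk0 sumE up low Sr Sq SrL Sr0} => // k _.
  have := @exprn_tangent_le R k (1 - 2 * delta) 1 d1 ler01.
  by rewrite !expr1n mulr1; lra.
set w := (1 - 2 * delta) ^+ k in bern *; set tk := t ^+ k in tk0 ht *.
set Lk := L ^+ k in hd ht SrL *.
rewrite -subr_gt0.
have -> : V k * w * (tk * Sr) - 2 * (V k * (tk * Lk)) ^+ 2 * n%:R - V k * (tk * Sq) =
    tk * V k * (w * Sr) - tk * V k * (Sq + n%:R * (2 * V k * Lk ^+ 2 * tk)) by ring.
rewrite subr_gt0.
rewrite ltr_pM2l ?mulr_gt0//.
have h1 : n%:R * (2 * V k * Lk ^+ 2 * tk) <= n%:R * (g / 4) by rewrite ler_wpM2l// ltW.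
have h2 : (1 - 2 * k%:R * delta) * Sr <= w * Sr by rewrite ler_wpM2r.
have h3 : 2 * k%:R * delta * Sr <= n%:R * (g / 4).
  apply: (@le_trans _ _ (2 * k%:R * delta * (n%:R * Lk))).
    by rewrite ler_wpM2l// !mulr_ge0.
  by rewrite mulrCA ler_wpM2l// ltW.
have h4 : 0 < n%:R * g by rewrite mulr_gt0.
lra.
Qed.

Lemma mu_le_support (k n : nat) (r : 'rV[R]_n) (t : R) :
  (0 < k)%N -> (0 < n)%N -> (forall i, 0 <= r ord0 i) -> 0 < t ->
  (mu k (t *: r) <= #|[set i | (0 < r ord0 i)%R]%SET|%:R%:E)%E.
Proof.
move=> k0 n0 r0 t0.
have tr0 i : 0 <= (t *: r) ord0 i by rewrite mxE mulr_ge0// ltW.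
apply: le_trans (mu_le_cover k0 n0 [set i | (0 < r ord0 i)%R]%SET tr0) _.
rewrite big1 ?mulr0 ?addr0// => i; rewrite inE -leNgt mxE => ri.
have -> : r ord0 i = 0 by apply/eqP; rewrite eq_le ri r0.
by rewrite mulr0 expr0n; case: k k0.
Qed.

(** The number l of cells per side is the least integer above z, and l = z would make
the diameter of a cell exactly t a n^(-1/k).  The last hypothesis says z >= 1, so
that rounding at most doubles z, whence the factor 2. *)
Lemma mu_ge_large (k n : nat) (q : 'rV[R]_n) (a t e : R) :
  (0 < k)%N -> (0 < n)%N -> 0 < a -> 0 < t -> 0 < e ->
  t * a * n%:R `^ (- k%:R^-1) <= Num.sqrt k%:R ->
  ((#|[set i | (a <= q ord0 i)%R]%SET|%:R
     - (2 * Num.sqrt k%:R / (t * a)) ^+ k * n%:R * e - n%:R / e)%:E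
   <= mu k (t *: q))%E.
Proof.
move=> k0 n0 a0 t0 e0 small.
have nR0 : 0 < n%:R :> R by rewrite ltr0n.
set s := n%:R `^ (- k%:R^-1) in small *.
have s0 : 0 < s by rewrite powR_gt0.
have sk : s ^+ k = n%:R^-1 by exact: powR_Ninv_exprn.
pose rho := t * a * s.
have rho0 : 0 < rho by rewrite !mulr_gt0.
pose z := Num.sqrt k%:R / rho.
have z1 : 1 <= z by rewrite ler_pdivlMr// mul1r.
pose l := (Num.truncn z).+1.
have zl : z <= l%:R by rewrite ltW// truncnS_gt.
have lz : l%:R <= 2 * z.
  have : (Num.truncn z)%:R <= z by rewrite truncn_le// (le_trans _ z1).
  by rewrite /l -natr1; lra.
have kl : k%:R <= (l%:R * rho) ^+ 2.
  have : Num.sqrt k%:R <= l%:R * rho by rewrite -ler_pdivrMr.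
  move=> h; rewrite -[leLHS](@sqr_sqrtr R)// lerXn2r ?nnegrE ?sqrtr_ge0//.
  by rewrite mulr_ge0// ltW.
have l0 : (0 < l)%N by [].
apply: le_trans (mu_ge_cells l0 (t *: q) (ltW rho0) kl e0).
rewrite lee_fin lerB// lerB//.
- rewrite ler_nat; apply/subset_leq_card/fintype.subsetP => i; rewrite !inE => aq.
  by rewrite /scaled_radius mxE ler_wpM2r ?powR_ge0// ler_wpM2l// ltW.
- rewrite ler_wpM2r ?(ltW e0)// natrX.
  apply: (@le_trans _ _ ((2 * z) ^+ k)); first by rewrite lerXn2r ?nnegrE// (le_trans _ lz).
  rewrite (_ : 2 * z = 2 * Num.sqrt k%:R / (t * a) * s^-1); last first.
    by rewrite /z /rho invfM !mulrA.
  by rewrite exprMn exprVn sk invrK.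
Qed.

Lemma ereal_between (A B : \bar R) : (A < B)%E -> exists x : R, (A < x%:E < B)%E.
Proof.
case: A B => [x| |] [y| |]//=; rewrite ?lte_fin => xy.
- by exists ((x + y) / 2); rewrite !lte_fin; apply/andP; split; lra.
- by exists (x + 1); rewrite lte_fin ltry ltrDl ltr01.
- by exists (y - 1); rewrite lte_fin ltNyr ltrBlDr ltrDl ltr01.
- by exists 0; rewrite ltNyr ltry.
Qed.

Lemma limn_esup_lt_near (u : (\bar R)^nat) (b : \bar R) :
  (limn_esup u < b)%E -> \forall n \near \oo, (u n < b)%E.
Proof.
move=> /ereal_inf_lt[_ [W WF <-] supb].
apply: filterS WF => n Wn; apply: le_lt_trans supb.
by apply: ereal_sup_ubound; exists n.
Qed.

Lemma limn_einf_gt_near (u : (\bar R)^nat) (b : \bar R) :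
  (b < limn_einf u)%E -> \forall n \near \oo, (b < u n)%E.
Proof.
rewrite /limn_einf lteNr => /limn_esup_lt_near.
by apply: filterS => n; rewrite lteN2.
Qed.

End comparisons.

Theorem theorem1 (R : realType) (k : nat) (hk : (2 <= k)%N)
  (L : R) (hL : 0 < L)
  (r q : forall n : nat, 'rV[R]_n)
  (hr : forall (n : nat) (i : 'I_n), (1 <= n)%N -> 0 <= r n ord0 i <= L)
  (hq : forall (n : nat) (i : 'I_n), (1 <= n)%N -> 0 <= q n ord0 i <= L)
  (hmaj : forall n : nat, (1 <= n)%N -> majorizes (r n) (q n))
  (a : R) (ha : 0 < a <= L)
  (hsupp :
    (limn_esup (fun n => (#|[set i : 'I_n | 0 < r n ord0 i]%SET|%:R / n%:R : R)%R%:E)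
     < limn_einf (fun n => (#|[set i : 'I_n | a <= q n ord0 i]%SET|%:R / n%:R : R)%R%:E))%E) :
  exists ts tl : R, [/\ 0 < ts, ts < tl,
    forall t : R, 0 < t < ts ->
      \forall n \near \oo, (mu k (t *: r n) > mu k (t *: q n))%E &
    forall t : R, tl < t ->
      \forall n \near \oo, (mu k (t *: r n) < mu k (t *: q n))%E].
Proof.
have k0 : (0 < k)%N by exact: ltnW.
have [x /andP[rx xq]] := ereal_between hsupp.
have [y /andP[xy yq]] := ereal_between xq.
move: xy; rewrite lte_fin => xy.
case/andP: ha => a0 _.
have near_r : \forall n \near \oo, #|[set i : 'I_n | 0 < r n ord0 i]%SET|%:R < x * n%:R.
  near=> n; have n0 : 0 < n%:R :> R by rewrite ltr0n; near: n; exact: nbhs_infty_gt.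
  by rewrite -ltr_pdivrMr// -lte_fin; near: n; exact: limn_esup_lt_near.
have near_q : \forall n \near \oo, y * n%:R < #|[set i : 'I_n | a <= q n ord0 i]%SET|%:R.
  near=> n; have n0 : 0 < n%:R :> R by rewrite ltr0n; near: n; exact: nbhs_infty_gt.
  by rewrite -ltr_pdivlMr// -lte_fin; near: n; exact: limn_einf_gt_near.
have V0 := ball_volume_gt0 R k.
pose D := y - x.
have D0 : 0 < D by rewrite subr_gt0.
pose g := k.-1%:R * a ^+ k * D.
have g0 : 0 < g by rewrite !mulr_gt0 ?exprn_gt0// ltr0n -subn1 subn_gt0.
have Lk0 : 0 < L ^+ k by rewrite exprn_gt0.
(* The scaled radii tend to 0, so they end up below any positive constant; this one
   makes the boundary effect at most g / 4. *)
pose delta := Num.min 2^-1 (g / 4 / (2 * k%:R * L ^+ k)).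
have kR0 : 0 < k%:R :> R by rewrite ltr0n.
have delta0 : 0 < delta by rewrite lt_min invr_gt0 ltr0n/= !divr_gt0// !mulr_gt0.
have delta1 : delta <= 2^-1 by rewrite ge_min lexx.
have hd : 2 * k%:R * delta * L ^+ k <= g / 4.
  rewrite mulrAC mulrC -ler_pdivlMr ?mulr_gt0//.
  by rewrite /delta ge_min lexx orbT.
pose ts := Num.min 1 (g / 4 / (2 * ball_volume R k * L ^+ k ^+ 2)).
have ts0 : 0 < ts by rewrite lt_min ltr01/= !divr_gt0// !mulr_gt0// exprn_gt0.
(* With e = 2 / D, the loss of the grid bound is w^k n (2 / D) + n D / 2 for
   w = 2 sqrt k / (t a); it is at most D n as soon as w <= kappa. *)
pose kappa := Num.min 1 (D ^+ 2 / 4).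
have kappa0 : 0 < kappa by rewrite lt_min ltr01/= divr_gt0// exprn_gt0.
pose sk : R := Num.sqrt k%:R.
have sk0 : 0 < sk by rewrite sqrtr_gt0.
exists ts, (Num.max (ts + 1) (2 * sk / (a * kappa))); split => //.
- by rewrite lt_max ltrDl ltr01.
- move=> t /andP[t0 tts].
  have ht : 2 * ball_volume R k * L ^+ k ^+ 2 * t ^+ k <= g / 4.
    have c0 : 0 < 2 * ball_volume R k * L ^+ k ^+ 2 by rewrite !mulr_gt0// exprn_gt0.
    rewrite mulrC -ler_pdivlMr//; apply: (@le_trans _ _ t).
      by rewrite -[leRHS]expr1 ler_wiXn2l// ltW// (lt_le_trans tts)// ge_min lexx.
    by rewrite (le_trans (ltW tts))// ge_min lexx orbT.
  near=> n.
  have n0 : (0 < n)%N by near: n; exact: nbhs_infty_gt.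
  apply: (@mu_lt_small R k n (r n) (q n) L g t delta) => //.
  + by move=> i; exact: hr.
  + by move=> i; case/andP: (hq n i n0).
  + have := @majorizes_sum_exprn R n k.-1 (r n) (q n) a (hmaj n n0).
    rewrite prednK// => /(_ _ _ (ltW a0)) gap.
    apply: le_trans (gap _ _); last 2 first.
    * by move=> i; case/andP: (hr n i n0).
    * by move=> i; case/andP: (hq n i n0).
    rewrite lerD2l /g -[leLHS]mulrA ler_wpM2l ?mulr_ge0 ?exprn_ge0 ?(ltW a0)//.
    have h1 : #|[set i : 'I_n | 0 < r n ord0 i]%SET|%:R < x * n%:R by near: n.
    have h2 : y * n%:R < #|[set i : 'I_n | a <= q n ord0 i]%SET|%:R by near: n.
    by rewrite /D; lra.
  + by rewrite ltW.
  + rewrite mulrC -ler_pdivlMr ?mulr_gt0//; near: n; apply: scale_le => //.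
    by rewrite divr_gt0// mulr_gt0.
- move=> t; rewrite gt_max => /andP[t1 t2].
  have t0 : 0 < t by rewrite (lt_trans _ t1)// addr_gt0.
  have ta0 : 0 < t * a by rewrite mulr_gt0.
  pose w := 2 * sk / (t * a).
  have w0 : 0 <= w by rewrite divr_ge0// ltW// mulr_gt0.
  have wk : w <= kappa.
    move: t2; rewrite ltr_pdivrMr ?mulr_gt0// => t2.
    by rewrite ler_pdivrMr// (_ : kappa * _ = t * (a * kappa)) 1?ltW//; ring.
  have wD : w ^+ k <= D ^+ 2 / 4.
    apply: (@le_trans _ _ w).
      rewrite -[leRHS]expr1 ler_wiXn2l// (le_trans wk)//.
      by rewrite ge_min lexx.
    by rewrite (le_trans wk)// ge_min lexx orbT.
  pose e := 2 / D.
  have e0 : 0 < e by rewrite divr_gt0.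
  near=> n.
  have n0 : (0 < n)%N by near: n; exact: nbhs_infty_gt.
  have nR0 : 0 < n%:R :> R by rewrite ltr0n.
  apply: le_lt_trans (@mu_le_support R k n (r n) t k0 n0 _ t0) _.
    by move=> i; case/andP: (hr n i n0).
  apply: lt_le_trans (@mu_ge_large R k n (q n) a t e k0 n0 a0 t0 e0 _); last first.
    rewrite mulrC -ler_pdivlMr//; near: n; apply: scale_le => //.
    by rewrite divr_gt0.
  rewrite lte_fin -/sk -/w.
  have h1 : #|[set i : 'I_n | 0 < r n ord0 i]%SET|%:R < x * n%:R by near: n.
  have h2 : y * n%:R < #|[set i : 'I_n | a <= q n ord0 i]%SET|%:R by near: n.
  have h3 : w ^+ k * n%:R * e <= D / 2 * n%:R.
    rewrite (_ : D / 2 * n%:R = D ^+ 2 / 4 * n%:R * e); last first.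
      by rewrite /e; field; exact: lt0r_neq0.
    by rewrite !ler_wpM2r// ltW.
  have h4 : n%:R / e = D / 2 * n%:R by rewrite /e; field; exact: lt0r_neq0.
  by rewrite h4 /D in h3 *; lra.
Unshelve. all: by end_near. Qed.
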